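(* Let $\mathcal B$ be a subfactorizable fusion bialgebra with minimal projections $p_0,\dots,p_n$ and fusion graphs $\Gamma_0,\dots,\Gamma_n$. Then $\mathcal B$ has an exchange relation if and only if every fusion graph $\Gamma_k$, $0\le k\le n$, is a forest (i.e. contains no cycle).
   Context: Fusion bialgebra: a unital $*$-algebra $\mathcal B$ over $\mathbb C$ with an $\mathbb R_{\ge0}$-basis, i.e. a linear basis $\{x_0=1_{\mathcal B},x_1,\dots,x_n\}$ with $x_jx_k=\sum_s\widetilde N_{j,k}^s x_s$, $\widetilde N_{j,k}^s\ge 0$, and an involution $*$ on $\{0,\dots,n\}$ with $x_k^*=x_{k^*}$ and $\widetilde N_{j,k}^0=\delta_{j,k^*}$. 2-boxes: let $\mathcal P$ be an irreducible subfactor planar algebra ($\dim\mathcal P_{1,\pm}=1$; the distinguished interval of elements of $\mathcal P_{n,+}$ is unshaded) with circle value $\delta$ and $\mathcal P_{2,+}$ abelian. Let $p_0,\dots,p_n$ be the minimal projections of $\mathcal P_{2,+}$, with $p_0$ the Jones projection ($\delta^{-1}$ times the cup-cap diagram). $\overline x$ is the $180^\circ$ rotation of $x$, and $\overline{p_i}=p_{\overline i}$. The quantum dimension $d_i$ is defined by: closing the right strand of $p_i$ gives $d_i$ times a strand. The convolution $x*y$ places $x$ to the left of $y$ and joins the two right-hand boundary points of $x$ to the two left-hand boundary points of $y$ (upper to upper, lower to lower). The fusion coefficients $N_{kj}^i\ge0$ are defined by $p_k*p_j=\sum_i N_{kj}^i p_i$. With convolution as product, $x\mapsto\overline x$ (on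 basis elements) as involution, and $x_j=\sqrt{\delta/d_j}\,p_j$ as $\mathbb R_{\ge0}$-basis, $\mathcal P_{2,+}$ is a fusion bialgebra (with $\widetilde N_{jk}^s=N_{jk}^s\sqrt{\delta d_s}/\sqrt{d_jd_k}$). A fusion bialgebra is subfactorizable if it can be realized in this way as the 2-box space $\mathcal P_{2,+}$ of an irreducible subfactor planar algebra $\mathcal P$. 3-boxes: write $XY$ for $X$ stacked on top of $Y$ in $\mathcal P_{3,+}$; $x\otimes 1$ for $x\in\mathcal P_{2,+}$ with a through strand added on the right; $1\otimes\mathfrak F_s(x)$ for the $90^\circ$ counterclockwise rotation of $x$ placed on strands 2,3, with a through strand on the left; $U$ for the through strand 1 together with the (unnormalized) cup-cap on strands 2,3. Put $E_1(i,j)=(p_i\otimes1)(1\otimes\mathfrak F_s(p_j))$, $E_2(s,t)=(p_s\otimes1)U(p_t\otimes1)$, $E_3(\ell,m)=(1\otimes\mathfrak F_s(p_\ell))(p_m\otimes1)$. $\mathcal P$ is an exchange relation planar algebra if it is generated by $\mathcal P_2$ and there are scalars with $E_1(i,j)=\sum_{s,t}a_{st}^{ij}E_2(s,t)+\sum_{\ell,m}b_{\ell m}^{ij}E_3(\ell,m)$ for all $i,j$. A subfactorizable fusion bialgebra has an exchange relation (has exchange relations) if it can be realized as the 2-box space of an exchange relation planar algebra. Fusion graph: $\Gamma_k$ is the bipartite graph with white vertices $0,\dots,n$ and black vertices $0,\dots,n$, in which white $i$ and black $j$ are joined by an edge if and only if $N_{kj}^i\neq0$ (equivalently $\widetilde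 N_{kj}^i\ne0$). *)

(* Defs.v *)
From HB Require Import structures.
From mathcomp Require Import all_boot all_order all_algebra all_field.
From mathcomp Require Import complex.
From mathcomp Require Import reals.
Set Implicit Arguments.
Unset Strict Implicit.
Unset Printing Implicit Defensive.
Import Order.TTheory GRing.Theory Num.Theory.
Local Open Scope ring_scope.

(** * Fusion bialgebras *)

Record fusionBialgebra (C : numClosedFieldType) (n : nat) := FusionBialgebra {
  fb_alg :> falgType C;
  fb_star : fb_alg -> fb_alg;
  fb_starD : forall (a : C) (x y : fb_alg),
    fb_star (a *: x + y) = a^* *: fb_star x + fb_star y;
  fb_starM : forall x y : fb_alg, fb_star (x * y) = fb_star y * fb_star x;
  fb_starK : involutive fb_star;
  fb_x : n.+1.-tuple fb_alg;
  fb_basis : basis_of {:fb_alg} fb_x;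
  fb_x0 : tnth fb_x ord0 = 1;
  fb_dual : 'I_n.+1 -> 'I_n.+1;
  fb_dualK : involutive fb_dual;
  fb_star_x : forall k, fb_star (tnth fb_x k) = tnth fb_x (fb_dual k);
  fb_coef_ge0 : forall j k s : 'I_n.+1,
    0 <= coord fb_x s (tnth fb_x j * tnth fb_x k);
  fb_coef0 : forall j k : 'I_n.+1,
    coord fb_x ord0 (tnth fb_x j * tnth fb_x k) = (j == fb_dual k)%:R }.

Definition fb_coef (C : numClosedFieldType) (n : nat)
    (B : fusionBialgebra C n) (j k s : 'I_n.+1) : C :=
  coord (fb_x B) s (tnth (fb_x B) j * tnth (fb_x B) k).

(** [inl] is a white vertex, [inr] a black one. *)
Definition fusion_graph (C : numClosedFieldType) (n : nat)
    (B : fusionBialgebra C n) (k : 'I_n.+1) : rel ('I_n.+1 + 'I_n.+1) :=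
  fun u v => match u, v with
  | inl i, inr j | inr j, inl i => fb_coef B k j i != 0
  | _, _ => false
  end.

(** The bound on the size excludes going back and forth along one edge. *)
Definition is_forest (T : eqType) (e : rel T) : Prop :=
  forall c : seq T, (2 < size c)%N -> ~~ ucycleb e c.

(** * Planar tangles

   Shaded planar tangles up to isotopy are encoded by combinatorial maps.
   The outer disc is disc 0, the input discs are 1, 2, ... A disc of color
   [(k, e)] has [2k] boundary points, numbered clockwise from 0 starting at
   the distinguished interval, which is unshaded iff [e] is [true].  Drawn as
   a box with the distinguished interval on its left, a disc has its points
   [0, ..., k-1] on top from left to right and [k, ..., 2k-1] at the bottom
   from right to left.

   [mate] sends each boundary point to the other end of its string.

   The position of the closed loops, and more generally of the connected
   components that do not meet the outer disc, is not recorded.  This is the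
   sphericality of subfactor planar algebras: since P_(0,+) and P_(0,-) are
   one-dimensional such a component only contributes a scalar, which does not
   depend on the region the component is drawn in. *)

Definition color := (nat * bool)%type.
Definition point := (nat * nat)%type.

Record tangle (ins : seq color) (out : color) := Tangle {
  mate : point -> point;
  loops : nat }.

Section Planarity.
Variables (ins : seq color) (out : color) (T : tangle ins out).
Local Open Scope nat_scope.

Definition disc_color (d : nat) : color := nth (0, true) (out :: ins) d.
Definition disc_deg (d : nat) : nat := ((disc_color d).1).*2.
Definition points : seq point :=
  [seq (d, j) | d <- iota 0 (size ins).+1, j <- iota 0 (disc_deg d)].

(** Whether the region on the left of the string leaving [p] is shaded;
   a string leaves the outer disc inwards. *)
Definition left_shaded (p : point) : bool :=
  odd p.2 (+) ~~ (disc_color p.1).2 (+) (p.1 == 0).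

Definition is_matching : bool :=
  all (fun p => [&& mate T p \in points, mate T (mate T p) == p &
                    left_shaded (mate T p) != left_shaded p]) points.

(** The next point clockwise around a disc seen as a vertex on the sphere:
   on the outer disc this reverses the numbering. *)
Definition next_point (p : point) : point :=
  (p.1, (if p.1 == 0 then p.2 + (disc_deg 0).-1 else p.2.+1) %% disc_deg p.1).

Definition reach (fs : seq (point -> point)) (p : point) : seq point :=
  iter (size points)
    (fun s => undup (s ++ [seq f x | f <- fs, x <- s])) [:: p].

(** The number of orbits on [points] of the group generated by the
   permutations [fs]. *)
Definition n_orbits (fs : seq (point -> point)) : nat :=
  count (fun p => all (fun q => index p points <= index q points) (reach fs p))
    points.

(** V + F = E + 2C.  The discs without boundary points are isolated vertices
   and do not matter. *)
Definition genus0 : bool :=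
  n_orbits [:: next_point] + n_orbits [:: next_point \o mate T] ==
  (size points)./2 + 2 * n_orbits [:: next_point; mate T].

Definition is_planar : bool := is_matching && genus0.
End Planarity.

Definition isotopic (ins : seq color) (out : color) (T T' : tangle ins out) :=
  (loops T == loops T') &&
  all (fun p => mate T p == mate T' p) (points ins out).

Definition id_tangle (c : color) : tangle [:: c] c :=
  Tangle _ _ (fun p => ((p.1 == 0)%N : nat, p.2)) 0.

Definition relabel (i : nat) (p : point) : point :=
  if p.1 == i then (i.+1, p.2) else if p.1 == i.+1 then (i, p.2) else p.

(** Exchanges the labels of two consecutive input discs. *)
Definition swap (cs ds : seq color) (c d out : color)
    (T : tangle (cs ++ c :: d :: ds) out) : tangle (cs ++ d :: c :: ds) out :=
  let s := relabel (size cs).+1 in Tangle _ _ (s \o mate T \o s) (loops T).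

(** Mirror image; in box form, the reflection in a horizontal line. *)
Definition reflect_tangle (ins : seq color) (out : color)
    (T : tangle ins out) : tangle ins out :=
  let r (p : point) := (p.1, (disc_deg ins out p.1 - p.2.+1)%N) in
  Tangle _ _ (r \o mate T \o r) (loops T).

(** Joins the strings ending at [a] and at [b] in a system of strings and
   loops; afterwards [a] and [b] are no longer endpoints. *)
Definition join (Q : eqType) (ml : (Q -> Q) * nat) (a b : Q) :
    (Q -> Q) * nat :=
  let ma := ml.1 a in let mb := ml.1 b in
  (fun p => if p == ma then mb else if p == mb then ma else ml.1 p,
   (ml.2 + (ma == b))%N).

(** Inserts [S] into the input disc of [T] with label [(size cs).+1].  The
   input discs of [S] take the place of this disc. *)
Definition glue (cs ds es : seq color) (c out : color)
    (T : tangle (cs ++ c :: ds) out) (S : tangle es c) :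
    tangle (cs ++ es ++ ds) out :=
  let i := (size cs).+1 in
  let enc (q : point + point) : point :=
    match q with
    | inl p => if (p.1 <= i)%N then p else ((p.1 + size es).-1, p.2)
    | inr p => ((p.1 + size cs)%N, p.2)
    end in
  let dec (p : point) : point + point :=
    if (p.1 < i)%N then inl p
    else if (p.1 < i + size es)%N then inr ((p.1 - size cs)%N, p.2)
    else inl ((p.1.+1 - size es)%N, p.2) in
  let m (q : point + point) : point + point :=
    match q with inl p => inl (mate T p) | inr p => inr (mate S p) end in
  let ml := foldl (fun ml j => join ml (inl (i, j)) (inr (0%N, j)))
              (m, (loops T + loops S)%N) (iota 0 (c.1).*2) in
  Tangle _ _ (enc \o ml.1 \o dec) ml.2.

(** * Subfactor planar algebras *)

Fixpoint inputs (V : color -> Type) (cs : seq color) : Type :=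
  if cs is c :: cs' then (V c * inputs V cs')%type else unit.

Fixpoint icat (V : color -> Type) (cs ds : seq color) :
    inputs V cs -> inputs V ds -> inputs V (cs ++ ds) :=
  match cs with
  | [::] => fun _ ys => ys
  | c :: cs' => fun xs ys => (xs.1, icat xs.2 ys)
  end.

(** [ins_at xs x ys] is the input [xs, x, ys]. *)
Definition ins_at (V : color -> Type) (cs ds : seq color) (c : color)
    (xs : inputs V cs) (x : V c) (ys : inputs V ds) :
    inputs V (cs ++ c :: ds) :=
  @icat V cs (c :: ds) xs (x, ys).

Fixpoint imap (V : color -> Type) (f : forall c, V c -> V c)
    (cs : seq color) : inputs V cs -> inputs V cs :=
  match cs with
  | [::] => id
  | c :: cs' => fun xs => (f c xs.1, imap f xs.2)
  end.

Fixpoint iall (V : color -> Type) (P : forall c, V c -> Prop)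
    (cs : seq color) : inputs V cs -> Prop :=
  match cs with
  | [::] => fun _ => True
  | c :: cs' => fun xs => P c xs.1 /\ iall P xs.2
  end.

(** [act] is only meaningful on tangles that satisfy [is_planar]. *)
Record planarData (C : numClosedFieldType) := PlanarData {
  space :> color -> vectType C;
  act : forall (ins : seq color) (out : color),
    tangle ins out -> inputs (fun c => space c) ins -> space out;
  star : forall c : color, space c -> space c;
  delta : C }.
Arguments star {C} p {c} _.
Arguments act {C} p {ins out} T _.

Section SubfactorPlanarAlgebra.
Variables (C : numClosedFieldType) (P : planarData C).
Notation inp := (inputs (fun c => P c)).

Definition empty_tangle (e : bool) : tangle [::] (0%N, e) := Tangle _ _ id 0.

(** Pairs the point [j] of one disc with its mirror image in the other. *)
Definition pairing_tangle (c : color) : tangle [:: c; c] (0%N, c.2) :=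
  Tangle _ _ (fun p => ((3 - p.1)%N, ((c.1).*2 - p.2.+1)%N)) 0.

Record is_subfactor_planar_algebra : Prop := {
  act_isotopic : forall ins out (T T' : tangle ins out) (xs : inp ins),
    is_planar T -> is_planar T' -> isotopic T T' -> act P T xs = act P T' xs;
  act_linear : forall cs ds c out (T : tangle (cs ++ c :: ds) out)
      (xs : inp cs) (ys : inp ds) (a : C) (x y : P c),
    is_planar T ->
    act P T (ins_at xs (a *: x + y) ys) =
    a *: act P T (ins_at xs x ys) + act P T (ins_at xs y ys);
  act_id : forall c (x : P c), act P (id_tangle c) (x, tt) = x;
  act_swap : forall cs ds c d out (T : tangle (cs ++ c :: d :: ds) out)
      (xs : inp cs) (ys : inp ds) (x : P c) (y : P d),
    is_planar T ->
    act P (swap T) (ins_at xs y ((x, ys) : inp (c :: ds))) =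
    act P T (ins_at xs x ((y, ys) : inp (d :: ds)));
  act_glue : forall cs ds es c out (T : tangle (cs ++ c :: ds) out)
      (S : tangle es c) (xs : inp cs) (ys : inp ds) (zs : inp es),
    is_planar T -> is_planar S ->
    act P (glue T S) (icat xs (icat zs ys)) =
    act P T (ins_at xs (act P S zs) ys);
  star_antilinear : forall c (a : C) (x y : P c),
    star P (a *: x + y) = a^* *: star P x + star P y;
  starK : forall c (x : P c), star P (star P x) = x;
  act_star : forall ins out (T : tangle ins out) (xs : inp ins),
    is_planar T ->
    star P (act P T xs) =
    act P (reflect_tangle T) (imap (fun c => @star C P c) xs);
  delta_gt0 : 0 < delta P;
  act_loops : forall ins out (m : point -> point) (l : nat) (xs : inp ins),
    is_planar (Tangle ins out m l) ->
    act P (Tangle ins out m l) xs = delta P ^+ l *: act P (Tangle ins out m 0) xs;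
  space0 : forall e, \dim {:P (0%N, e)} = 1%N;
  inner_prod_gt0 : forall c (x : P c), x != 0 ->
    exists2 s : C, 0 < s &
      act P (pairing_tangle c) (x, (star P x, tt)) =
      s *: act P (empty_tangle c.2) tt }.

Definition is_irreducible : Prop := forall e, \dim {:P (1%N, e)} = 1%N.

(** The only planar subalgebra containing the 2-boxes is the whole of [P]. *)
Definition generated_by_2boxes : Prop :=
  forall W : (forall c, {vspace P c}),
    (forall e, W (2%N, e) = fullv) ->
    (forall ins out (T : tangle ins out) (xs : inp ins), is_planar T ->
       iall (fun c (x : P c) => x \in W c) xs -> act P T xs \in W out) ->
    forall c, W c = fullv.

(** * 2-boxes and 3-boxes *)

Fixpoint partner (s : seq (point * point)) (p : point) : point :=
  if s is (a, b) :: s' then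
    if p == a then b else if p == b then a else partner s' p
  else p.

Definition of_strings ins out (s : seq (point * point)) : tangle ins out :=
  Tangle _ _ (partner s) 0.

Definition mul_tangle (c : color) : tangle [:: c; c] c :=
  Tangle _ _ (fun p => let: (d, j) := p in
    let top := (j < c.1)%N in
    let opp := ((c.1).*2 - j.+1)%N in
    match d with
    | 0 => if top then (1, j) else (2, j)
    | 1 => if top then (0, j) else (2, opp)
    | _ => if top then (1, opp) else (0, j)
    end)%N 0.

(** [mul x y] is [x] on top of [y]. *)
Definition mul c (x y : P c) : P c := act P (mul_tangle c) (x, (y, tt)).

Definition c1 : color := (1%N, true).
Definition c2 : color := (2%N, true).
Definition c3 : color := (3%N, true).

Local Notation "a -- b" := (a%N, b%N) (at level 40).

Definition strand : P c1 :=
  act P (of_strings [::] c1 [:: (0, 0) -- (0, 1)]) tt.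

Definition cup_cap : P c2 :=
  act P (of_strings [::] c2 [:: (0, 0) -- (0, 1); (0, 2) -- (0, 3)]) tt.

Definition jones_proj : P c2 := (delta P)^-1 *: cup_cap.

Definition rot180 (x : P c2) : P c2 :=
  act P (of_strings [:: c2] c2
    [:: (0, 0) -- (1, 2); (0, 1) -- (1, 3);
        (0, 2) -- (1, 0); (0, 3) -- (1, 1)]) (x, tt).

Definition close_right (x : P c2) : P c1 :=
  act P (of_strings [:: c2] c1
    [:: (0, 0) -- (1, 0); (0, 1) -- (1, 3); (1, 1) -- (1, 2)]) (x, tt).

Definition conv (x y : P c2) : P c2 :=
  act P (of_strings [:: c2; c2] c2
    [:: (0, 0) -- (1, 0); (0, 3) -- (1, 3);
        (1, 1) -- (2, 0); (1, 2) -- (2, 3);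
        (0, 1) -- (2, 1); (0, 2) -- (2, 2)]) (x, (y, tt)).

(** The through strand is added on the right. *)
Definition tens_id (x : P c2) : P c3 :=
  act P (of_strings [:: c2] c3
    [:: (0, 0) -- (1, 0); (0, 1) -- (1, 1);
        (0, 4) -- (1, 2); (0, 5) -- (1, 3); (0, 2) -- (0, 3)]) (x, tt).

(** 1 (x) F_s(x): under the counterclockwise quarter turn the corners 1, 2, 3,
   0 of [x] become top left, top right, bottom right and bottom left. *)
Definition id_tens_fourier (x : P c2) : P c3 :=
  act P (of_strings [:: c2] c3
    [:: (0, 1) -- (1, 1); (0, 2) -- (1, 2);
        (0, 3) -- (1, 3); (0, 4) -- (1, 0); (0, 0) -- (0, 5)]) (x, tt).

Definition U3 : P c3 :=
  act P (of_strings [::] c3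
    [:: (0, 0) -- (0, 5); (0, 1) -- (0, 2); (0, 3) -- (0, 4)]) tt.

Definition is_projection (p : P c2) : Prop := mul p p = p /\ star P p = p.

Definition is_minimal_projection (p : P c2) : Prop :=
  [/\ is_projection p, p != 0 &
      forall q, is_projection q -> mul p q = q -> mul q p = q ->
        q = 0 \/ q = p].

(** An irreducible subfactor planar algebra with abelian 2-box space whose
   minimal projections are [p 0, ..., p n], with [p 0] the Jones projection. *)
Record is_abelian_with (n : nat) (p : 'I_n.+1 -> P c2) : Prop := {
  aw_subfactor : is_subfactor_planar_algebra;
  aw_irreducible : is_irreducible;
  aw_comm : forall x y : P c2, mul x y = mul y x;
  aw_inj : injective p;
  aw_minimal : forall q, is_minimal_projection q <-> exists i, q = p i;
  aw_jones : p ord0 = jones_proj }.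

Definition E1 (n : nat) (p : 'I_n.+1 -> P c2) (i j : 'I_n.+1) : P c3 :=
  mul (tens_id (p i)) (id_tens_fourier (p j)).

Definition E2 (n : nat) (p : 'I_n.+1 -> P c2) (s t : 'I_n.+1) : P c3 :=
  mul (mul (tens_id (p s)) U3) (tens_id (p t)).

Definition E3 (n : nat) (p : 'I_n.+1 -> P c2) (l m : 'I_n.+1) : P c3 :=
  mul (id_tens_fourier (p l)) (tens_id (p m)).

Definition is_exchange_relation (n : nat) (p : 'I_n.+1 -> P c2) : Prop :=
  generated_by_2boxes /\
  exists a b : 'I_n.+1 -> 'I_n.+1 -> 'I_n.+1 -> 'I_n.+1 -> C,
    forall i j, E1 p i j =
      \sum_s \sum_t a i j s t *: E2 p s t +
      \sum_l \sum_m b i j l m *: E3 p l m.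

(** [B] is isomorphic, as an algebra with R_{>=0}-basis and involution, to the
   2-box space of [P] with basis sqrt(delta / d_j) p_j. *)
Definition realizes (n : nat) (p : 'I_n.+1 -> P c2)
    (B : fusionBialgebra C n) : Prop :=
  is_abelian_with p /\
  exists (d : 'I_n.+1 -> C) (phi : {linear B -> P c2}),
    [/\ forall j, close_right (p j) = d j *: strand,
        bijective phi,
        forall x y, phi (x * y) = conv (phi x) (phi y),
        forall j, phi (tnth (fb_x B) j) = sqrtC (delta P / d j) *: p j &
        forall j, phi (fb_star (tnth (fb_x B) j)) =
                  rot180 (phi (tnth (fb_x B) j))].

End SubfactorPlanarAlgebra.

Definition subfactorizable (C : numClosedFieldType) (n : nat)
    (B : fusionBialgebra C n) : Prop :=
  exists (P : planarData C) (p : 'I_n.+1 -> P c2), realizes p B.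

Definition has_exchange_relation (C : numClosedFieldType) (n : nat)
    (B : fusionBialgebra C n) : Prop :=
  exists (P : planarData C) (p : 'I_n.+1 -> P c2),
    realizes p B /\ is_exchange_relation p.

(* Main.v *)
Require Import Defs.
From mathcomp Require Import all_boot all_order all_algebra all_field.
From mathcomp Require Import complex.
From mathcomp Require Import reals.
From mathcomp Require boolp.
From mathcomp Require Import zify.
(* [mul] would otherwise denote a constant on fractions. *)
Import Defs.
Set Implicit Arguments.
Unset Strict Implicit.
Unset Printing Implicit Defensive.
Import Order.TTheory GRing.Theory Num.Theory.

(** Write [P_s] for the 2-box [p_s] with a through strand on the right, [Q_l]
   for the quarter turn of [p_l] with a through strand on the left, and [U] for
   the cup-cap on strands 2 and 3.  The [P_s] are orthogonal idempotents with
   sum 1, so an identity between 3-boxes can be checked on the corners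
   [P_s X P_m].  In the corner [(s, m)] the three families of the exchange
   relation become
   - [E_1(i,j)]: [P_s Q_j P_m] if [s = i], and 0 otherwise;
   - [E_2(s',t)]: [P_s U P_m] if [(s', t) = (s, m)], and 0 otherwise;
   - [E_3(l,m')]: [P_s Q_l P_m] if [m' = m], and 0 otherwise;
   and [U] is the sum of the [Q_l], because the identity 2-box is the sum of
   the [p_l].  Everything is thus expressed by the 3-boxes
   [T_m(s,l) = P_s Q_l P_m] (lemma [corner_exchange]).  Stacking [p_l'] under
   [p_l] multiplies [T_m(s,l)] by 1 if [l = l'] and by 0 otherwise, so for fixed
   [s] and [m] the nonzero [T_m(s,l)] are linearly independent.  Hence the
   exchange relation holds iff for all [m], [i], [j] there are scalars [a_s],
   [b_l] such that
     [a_s + b_l] is 1 if [(s, l) = (i, j)] and 0 otherwise,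
   for all [(s, l)] such that [T_m(s,l)] is nonzero (lemma [exchangeP]).

   The square norm of [T_m(s,l)] is a closed diagram, three 2-boxes joined two
   by two by a pair of strings; read in another way it is the trace of
   [p_s (p_m * p_l)].  So [T_m(s,l)] is nonzero iff white [s] and black [l] are
   adjacent in [Gamma_m] (lemma [box_triangle_coef]).  Reading [a] on white
   vertices and [-b] on black ones as a potential, the condition on [a] and [b]
   says that the potential drops along the edge [(i, j)] and along no other
   one.  Such a potential exists iff [(i, j)] is a bridge, and a graph is a
   forest iff all its edges are bridges (lemma [fusion_forestP]).

   This shows that every realization of [B] satisfies the exchange relation
   iff the fusion graphs are forests.  If they are, one must still find a
   realization that is generated by its 2-boxes: any realization can be
   replaced by the planar subalgebra that its 2-boxes generate, which has the
   same 2-box space.  That this subalgebra is closed under the involution uses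
   that the mirror image of a planar tangle is planar (lemma
   [planar_reflect]). *)

(** * Orbits of permutations of boundary points *)

(** An injection of a finite set into itself has finite order, so that the
   inverse of each generator is one of its iterates: this makes [conn], which
   only follows the generators forwards, symmetric. *)
Lemma iter_return (X : eqType) (s : seq X) (f : X -> X) (x : X) :
  {in s, forall y, f y \in s} -> {in s &, injective f} -> x \in s ->
  exists k, iter k f (f x) = x.
Proof.
move=> f_s f_inj x_s.
have it_s k : iter k f x \in s by elim: k => //= k; apply: f_s.
have lem i j : iter (i + j) f x = iter i f x -> iter j f x = x.
  by elim: i => // i IHi /f_inj-/(_ (it_s _) (it_s _)).
have : ~~ uniq (traject f x (size s).+1).
  have sub_s : {subset traject f x (size s).+1 <= s} by move=> _
    /trajectP[k _ ->].
  by apply/negP=> /uniq_leq_size-/(_ s sub_s); rewrite size_traject ltnn.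
rewrite looping_uniq negbK => /trajectP[i lt_i].
rewrite -(subnKC (ltnW lt_i)) => /lem; case: (size s - i) (subn_gt0 i (size s))
  => [|k _ xk].
  by rewrite lt_i.
by exists k; rewrite -iterSr.
Qed.

Section Orbits.
Variables (ins : seq color) (out : color).
Notation pts := (points ins out).
Implicit Types (fs gs : seq (point -> point)) (p q : point).

Definition step fs : rel point := fun p q => has (fun f => f p == q) fs.
Definition conn fs p q := exists2 w, path (step fs) p w & q = last p w.

(** Stated by recursion because functions have no decidable equality, hence no
   membership in [fs]. *)
Definition permutes fs :=
  foldr (fun f => and ({in pts, forall p, f p \in pts} /\
    {in pts &, injective f})) True fs.

Lemma conn1 fs p q : step fs p q -> conn fs p q.
Proof. by move=> pq; exists [:: q] => //=; rewrite pq. Qed.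

Lemma conn_trans fs p q r : conn fs p q -> conn fs q r -> conn fs p r.
Proof.
move=> [w pw ->] [w' pw' ->]; exists (w ++ w'); first by rewrite cat_path pw.
by rewrite last_cat.
Qed.

Lemma permutes_step fs p q : permutes fs -> p \in pts -> step fs p q ->
  q \in pts /\ conn fs q p.
Proof.
move=> perm_fs p_pts.
have ex_f : step fs p q -> exists f,
  [/\ f p = q, {in pts, forall p, f p \in pts},
    {in pts &, injective f} & forall x, step fs x (f x)].
  elim: fs perm_fs => //= f fs IHfs [[f_pts f_inj] perm_fs] /orP[/eqP fp | pq].
    by exists f; split=> // x; rewrite /step /= eqxx.
  have [g [gp g_pts g_inj g_step]] := IHfs perm_fs pq.
  by exists g; split=> // x; rewrite /step /= -/(step _ _ _) g_step orbT.
case/ex_f=> f [<- f_pts f_inj f_step]; split; first exact: f_pts.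
have [k {2}<-] := iter_return f_pts f_inj p_pts.
elim: k (f p) => [|k IHk] y; first by exists [::].
by rewrite iterSr; apply: conn_trans (IHk _); apply/conn1/f_step.
Qed.

Lemma conn_pts fs p q : permutes fs -> p \in pts -> conn fs p q -> q \in pts.
Proof.
move=> perm_fs + [w]; elim: w p => [|x w IHw] p p_pts /=; first by move=> _ ->.
case/andP=> px; apply: IHw; exact: (permutes_step perm_fs p_pts px).1.
Qed.

Lemma conn_sym fs p q : permutes fs -> p \in pts -> conn fs p q -> conn fs q p.
Proof.
move=> perm_fs + [w]; elim: w p => [|x w IHw] p p_pts /=.
  by move=> _ ->; exists [::].
case/andP=> px xw def_q; have [x_pts xp] := permutes_step perm_fs p_pts px.
exact: conn_trans (IHw _ x_pts xw def_q) xp.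
Qed.

(** A shortest path visits each point at most once, so that the number of
   rounds performed by [reach] is sufficient. *)
Lemma reachP fs p q : permutes fs -> p \in pts ->
  q \in reach ins out fs p <-> conn fs p q.
Proof.
move=> perm_fs p_pts.
have stepE (s : seq point) y :
    (y \in [seq f x | f <- fs, x <- s]) = has (fun x => step fs x y) s.
  elim: fs {perm_fs} => [|f fs IHfs] /=; first by rewrite (eq_has (a2 := pred0))
    ?has_pred0.
  rewrite mem_cat IHfs [RHS](has_predU (fun x => f x == y) (step fs ^~ y));
    congr orb.
  by apply/mapP/hasP => -[x x_s fx]; exists x => //;
    [rewrite fx | rewrite (eqP fx)].
have iterP k y : y \in iter k
  (fun s => undup (s ++ [seq f x | f <- fs, x <- s])) [:: p] <->
    exists w, [/\ size w <= k, path (step fs) p w & y = last p w].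
  elim: k y => [|k IHk] y /=.
    rewrite inE; split=> [/eqP-> | [[|x w] [] // _ _ ->] //]; by exists [::].
  rewrite mem_undup mem_cat stepE; split.
    case/orP=> [/IHk[w [sw pw ->]] | /hasP[x /IHk[w [sw pw ->]] xy]].
      by exists w; split=> //; apply: leqW.
    by exists (rcons w y); rewrite size_rcons rcons_path last_rcons pw.
  case=> w; case: (lastP w) => [|{}w z] [sw pw ->].
    by apply/orP; left; apply/IHk; exists [::].
  move: sw pw; rewrite size_rcons rcons_path last_rcons ltnS => sw /andP[pw wz].
  apply/orP; right; apply/hasP; exists (last p w) => //.
  by apply/IHk; exists w.
rewrite /reach; split=> [/iterP[w [_ pw ->]] | [w pw def_q]]; first by exists w.
apply/iterP; case/shortenP: pw def_q => w' pw' uniq_w' _ ->; exists w';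
  split=> //.
apply: leq_trans (leqnSn _) _; apply: (uniq_leq_size uniq_w') => x x_w'.
apply: (conn_pts perm_fs p_pts); case/splitPl: x_w' pw' => w1 w2 <-.
by rewrite cat_path => /andP[pw1 _]; exists w1.
Qed.

(** Orbits are counted by their first points in the enumeration of [points].
   If [g] sends points connected by [gs] to points connected by [fs] and has a
   section [h], then sending [p] to the first point in the orbit of [h p] separates the orbits of
   [fs].  Only an inequality is asked for, so that [g] need not reflect
   connectedness; equalities follow by exchanging the two sides. *)
Lemma leq_n_orbits fs gs (g h : point -> point) :
  permutes fs -> permutes gs -> {in pts, forall p, h p \in pts} ->
  {in pts, cancel h g} ->
  (forall p q, p \in pts -> step gs p q -> conn fs (g p) (g q)) ->
  n_orbits ins out fs <= n_orbits ins out gs.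
Proof.
move=> perm_fs perm_gs h_pts hK g_step.
have g_conn p q : p \in pts -> conn gs p q -> conn fs (g p) (g q).
  move=> + [w]; elim: w p => [|x w IHw] p p_pts /=; first by move=> _ ->;
    exists [::].
  case/andP=> px xw def_q; apply: conn_trans (g_step _ _ p_pts px) _.
  exact: IHw (permutes_step perm_gs p_pts px).1 xw def_q.
have uniq_pts : uniq pts.
  rewrite allpairs_uniq_dep ?iota_uniq // => [d _|]; first exact: iota_uniq.
  by move=> [d j] [d' j'] _ _ /= [-> ->].
pose rep gs p := all (fun q => index p pts <= index q pts) (reach ins out gs p).
have ex_rep p : p \in pts -> exists2 q, q \in filter (rep gs) pts & conn gs p q.
  move=> p_pts.
  have [i [q q_conn def_i] i_min] : exists2 i,
    (exists2 q, conn gs p q & index q pts = i) &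
      forall q, conn gs p q -> i <= index q pts.
    have ex_i : exists i, has (fun q => index q pts == i) (reach ins out gs p).
      exists (index p pts); apply/hasP; exists p => //.
      by apply/(reachP _ perm_gs p_pts); exists [::].
    exists (ex_minn ex_i); case: ex_minnP => i /hasP[q q_p /eqP qi] i_min.
      by exists q => //; apply/(reachP _ perm_gs p_pts).
    by move=> q' /(reachP _ perm_gs p_pts) q'_p; apply: i_min; apply/hasP;
      exists q'.
  have q_pts := conn_pts perm_gs p_pts q_conn.
  exists q => //; rewrite mem_filter q_pts andbT; apply/allP=> x.
  move/(reachP _ perm_gs q_pts) => qx; rewrite def_i; apply: i_min.
  exact: conn_trans q_conn qx.
have [k kP] : exists k, forall p, p \in pts ->
    k p \in filter (rep gs) pts /\ conn gs (h p) (k p).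
  pose k p := nth p (filter (rep gs) pts)
     (find (fun q => q \in reach ins out gs (h p)) (filter (rep gs) pts)).
  exists k => p p_pts; have [q q_rep q_conn] := ex_rep _ (h_pts p p_pts).
  have has_q : has (fun q => q \in reach ins out gs (h p))
    (filter (rep gs) pts).
    by apply/hasP; exists q => //; apply/(reachP _ perm_gs (h_pts _ p_pts)).
  split; first by rewrite mem_nth // -has_find.
  by apply/(reachP _ perm_gs (h_pts _ p_pts)); apply: (nth_find p has_q).
rewrite /n_orbits -!size_filter -(size_map k); apply: uniq_leq_size.
  rewrite map_inj_in_uniq ?filter_uniq // => p q.
  rewrite !mem_filter => /andP[rep_p p_pts] /andP[rep_q q_pts] kpq.
  have [_ pk] := kP p p_pts; have [_ qk] := kP q q_pts.
  have hpq : conn gs (h p) (h q).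
    by apply: conn_trans pk _; rewrite kpq; apply: conn_sym qk => //;
      apply: h_pts.
  have pq : conn fs p q by have := g_conn _ _ (h_pts p p_pts) hpq; rewrite !hK.
  have qp := conn_sym perm_fs p_pts pq.
  move/allP: rep_p => /(_ q) /(_ ((reachP _ perm_fs p_pts).2 pq)) le_pq.
  move/allP: rep_q => /(_ p) /(_ ((reachP _ perm_fs q_pts).2 qp)) le_qp.
  have eq_pq : index p pts = index q pts by apply/eqP; rewrite eqn_leq le_pq.
  by rewrite -(nth_index p p_pts) eq_pq nth_index.
move=> _ /mapP[p + ->]; rewrite mem_filter => /andP[_ p_pts].
exact: (kP p p_pts).1.
Qed.
End Orbits.

(** * Planarity of mirror images *)

Section Reflect.
Variables (ins : seq color) (out : color).
Notation pts := (points ins out).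
Notation deg := (disc_deg ins out).
Notation next := (next_point ins out).

Definition flip (p : point) : point := (p.1, deg p.1 - p.2.+1).

Lemma mem_points p : (p \in pts) = (p.1 <= size ins) && (p.2 < deg p.1).
Proof.
case: p => d j; apply/allpairsPdep/andP =>
  /= [[d' [j' [+ + [-> ->]]]] | [d_lt j_lt]].
  by rewrite -[0 :: _]/(iota 0 (size ins).+1) !mem_iota.
by exists d, j; rewrite -[0 :: _]/(iota 0 (size ins).+1) !mem_iota.
Qed.

Lemma flip_pts : {in pts, forall p, flip p \in pts}.
Proof.
by move=> p; rewrite !mem_points /= => /andP[-> j_lt];
  rewrite subnS prednK ?leq_subr ?subn_gt0 //; lia.
Qed.

Lemma flipK : {in pts, cancel flip flip}.
Proof.
by case=> d j; rewrite mem_points /flip /= => /andP[_ j_lt]; congr pair; lia.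
Qed.

Lemma next_pts : {in pts, forall p, next p \in pts}.
Proof.
move=> p; rewrite !mem_points /= => /andP[-> j_lt] /=.
by rewrite ltn_mod (leq_ltn_trans _ j_lt).
Qed.

(** The mirror image reverses the cyclic order around each disc; this form of
   the conjugation relation avoids naming the inverse of [next]. *)
Lemma next_flip_next : {in pts, forall p, next (flip (next p)) = flip p}.
Proof.
case=> d j; rewrite mem_points /flip /next_point /= => /andP[_ j_lt];
  congr pair.
case: eqP j_lt => [-> |_]; [move: (deg 0) | move: (deg d)] => D j_lt.
  case: j j_lt => [|j] j_lt.
    by rewrite add0n (modn_small (_ : D.-1 < D)) ?(modn_small (_ : _ + _ < D));
      lia.
  have -> : j.+1 + D.-1 = j + D by lia.
  rewrite modnDr (modn_small (_ : j < D)); last lia.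
  have -> : D - j.+1 + D.-1 = D - j.+2 + D by lia.
  by rewrite modnDr modn_small; lia.
have [lt_j | ge_j] := ltnP j.+1 D.
  by rewrite (modn_small lt_j) modn_small; lia.
have -> : j.+1 = D by lia.
by rewrite modnn subn1 prednK ?modnn ?subnn //; lia.
Qed.

Lemma next_inj : {in pts &, injective next}.
Proof.
move=> p q p_pts q_pts eq_pq; rewrite -(flipK p_pts) -(flipK q_pts).
by rewrite -(next_flip_next p_pts) -(next_flip_next q_pts) eq_pq.
Qed.

Lemma left_shaded_flip :
  {in pts, forall p, left_shaded ins out (flip p) = ~~ left_shaded ins out p}.
Proof.
case=> d j; rewrite mem_points /left_shaded /flip /= => /andP[_ j_lt].
rewrite oddB // /disc_deg odd_double /=.
by case: (odd j) (d == 0) ((disc_color _ _ _).2) => [] [] [].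
Qed.

Section OneTangle.
Variable T : tangle ins out.
Hypothesis T_matching : is_matching T.

Lemma mate_pts : {in pts, forall p, mate T p \in pts}.
Proof. by move=> p /(allP T_matching)/and3P[]. Qed.

Lemma mateK : {in pts, cancel (mate T) (mate T)}.
Proof. by move=> p /(allP T_matching)/and3P[_ /eqP]. Qed.

Lemma mate_inj : {in pts &, injective (mate T)}.
Proof. exact: can_in_inj mateK. Qed.

Lemma mate_reflect p : mate (reflect_tangle T) p = flip (mate T (flip p)).
Proof. by []. Qed.

Lemma reflect_matching : is_matching (reflect_tangle T).
Proof.
apply/allP=> p p_pts; have fp_pts := flip_pts p_pts; have mfp_pts :=
  mate_pts fp_pts.
rewrite !mate_reflect flip_pts //= flipK // mateK // flipK // eqxx /=.
rewrite left_shaded_flip // -[p in X in _ != X](flipK p_pts) left_shaded_flip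
  //.
by rewrite (inj_eq negb_inj); case/and3P: (allP T_matching _ fp_pts).
Qed.

Lemma permutes_next_mate :
  [/\ permutes ins out [:: next], permutes ins out [:: next \o mate T] &
      permutes ins out [:: next; mate T]].
Proof.
have next_perm := conj next_pts next_inj; have mate_perm :=
  conj mate_pts mate_inj.
split=> //; do !split=> //.
  by move=> p p_pts; apply/next_pts/mate_pts.
by move=> p q p_pts q_pts /next_inj eq_m; apply: mate_inj => //; apply: eq_m;
  apply: mate_pts.
Qed.
End OneTangle.

Lemma leq_orbits_reflect (T T' : tangle ins out) :
  is_matching T -> is_matching T' ->
  {in pts, forall p, mate T' p = flip (mate T (flip p))} ->
  n_orbits ins out [:: next \o mate T] <=
    n_orbits ins out [:: next \o mate T'] /\
  n_orbits ins out [:: next; mate T] <= n_orbits ins out [:: next; mate T'].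
Proof.
move=> mT mT' mateE.
have [_ permT2 permT3] := permutes_next_mate mT.
have [_ permT'2 permT'3] := permutes_next_mate mT'.
have m_pts := mate_pts mT; have mK := mateK mT.
split; last first.
  apply: (leq_n_orbits (h := flip) (g := flip)) => //;
    [exact: flip_pts|exact: flipK|].
  move=> p q p_pts; rewrite /step /= orbF => /orP[] /eqP <-.
    (* [flip] conjugates [next] to its inverse, so the arrow is reversed. *)
    apply: (conn_sym permT3); first by apply/flip_pts/next_pts.
    by apply: conn1; rewrite /step /= next_flip_next ?eqxx.
  by apply: conn1; rewrite /step /= mateE // flipK ?eqxx ?orbT //;
    apply/m_pts/flip_pts.
(* Conjugating by [flip] turns [next \o mate T] into the composite of the
   inverse of [next] and [mate T']; the inverse of the latter is conjugate to
   [next \o mate T'] by [mate T'].  Hence these two bijections. *)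
apply: (leq_n_orbits (h := flip \o mate T) (g := mate T \o flip)) => //.
- by move=> p p_pts; apply/flip_pts/m_pts.
- by move=> p p_pts /=; rewrite flipK ?mK ?m_pts.
move=> p q p_pts; rewrite /step /= orbF => /eqP <-.
have m'p_pts := mate_pts mT' p_pts; have fp_pts := flip_pts p_pts.
apply: (conn_sym permT2); first by apply/m_pts/flip_pts/next_pts.
apply: conn1; rewrite /step /= mK ?flip_pts ?next_pts // next_flip_next // mateE
  //.
by rewrite flipK ?m_pts // eqxx.
Qed.

(** The mirror image is conjugate to [T] up to orientation, which preserves the
   numbers of discs, strings, regions and components in the Euler formula. *)
Lemma planar_reflect (T : tangle ins out) : is_planar T ->
  is_planar (reflect_tangle T).
Proof.
case/andP=> mT; have mT' := reflect_matching mT; rewrite /is_planar mT' /=.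
have [le1 le2] := leq_orbits_reflect mT mT' (fun p _ => erefl).
have [|ge1 ge2] := leq_orbits_reflect mT' mT.
  by move=> p p_pts; rewrite mate_reflect (flipK p_pts) flipK // (mate_pts mT).
by rewrite /genus0 => /eqP E; apply/eqP; lia.
Qed.
End Reflect.

Local Open Scope ring_scope.

(** * Diagram identities in low degree *)

Section Diagrams.
Variables (C : numClosedFieldType) (P : planarData C).
Hypothesis HP : is_subfactor_planar_algebra P.
Notation inp := (inputs (fun c => P c)).

(** Computes a composite of explicit tangles.  The premise only involves the
   combinatorics of the tangles and is decided by evaluation, which is how all
   the diagram identities below are proved. *)
Lemma act_subst cs ds es c out (T : tangle (cs ++ c :: ds) out)
    (S : tangle es c) (R : tangle (cs ++ es ++ ds) out) (xs : inp cs)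
    (ys : inp ds) (zs : inp es) :
  [&& is_planar T, is_planar S, is_planar (glue T S), is_planar R &
     isotopic (glue T S) R] ->
  act P T (ins_at xs (act P S zs) ys) = act P R (icat xs (icat zs ys)).
Proof.
case/and5P=> pT pS pG pR iso.
by rewrite -(act_glue HP xs ys zs pT pS) (act_isotopic HP _ pG pR iso).
Qed.

Local Notation "a -- b" := (a%N, b%N) (at level 40).

Lemma act_glueE cs ds es c out (T : tangle (cs ++ c :: ds) out)
    (S : tangle es c) (xs : inp cs) (ys : inp ds) (zs : inp es) :
  is_planar T && is_planar S ->
  act P T (ins_at xs (act P S zs) ys) = act P (glue T S) (icat xs (icat zs ys)).
Proof. by case/andP=> pT pS; rewrite (act_glue HP xs ys zs pT pS). Qed.

Lemma act_swapE cs ds c d out (T : tangle (cs ++ c :: d :: ds) out)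
    (xs : inp cs) (ys : inp ds) (x : P c) (y : P d) :
  is_planar T ->
  act P T (ins_at xs x ((y, ys) : inp (d :: ds))) =
  act P (swap T) (ins_at xs y ((x, ys) : inp (c :: ds))).
Proof. by move=> pT; rewrite (act_swap HP). Qed.

Definition mul3_tangle : tangle [:: c3; c3; c3] c3 :=
  of_strings [:: c3; c3; c3] c3 [::
    (0, 0) -- (1, 0); (0, 1) -- (1, 1); (0, 2) -- (1, 2);
    (1, 3) -- (2, 2); (1, 4) -- (2, 1); (1, 5) -- (2, 0);
    (2, 3) -- (3, 2); (2, 4) -- (3, 1); (2, 5) -- (3, 0);
    (0, 3) -- (3, 3); (0, 4) -- (3, 4); (0, 5) -- (3, 5)].

Lemma mul3_mulE (x y z : P c3) :
  mul (mul x y) z = act P mul3_tangle (x, (y, (z, tt))).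
Proof.
by apply: (@act_subst [::] [:: c3] [:: c3; c3] c3 c3 _ _ _ tt (z, tt)
  (x, (y, tt))); vm_compute.
Qed.

Lemma mul3A (x y z : P c3) : mul x (mul y z) = mul (mul x y) z.
Proof.
rewrite mul3_mulE.
by apply: (@act_subst [:: c3] [::] [:: c3; c3] c3 c3 _ _ _ (x, tt) tt
  (y, (z, tt))); vm_compute.
Qed.

Definition id2_tangle : tangle [::] c2 :=
  of_strings [::] c2 [:: (0, 0) -- (0, 3); (0, 1) -- (0, 2)].
Definition id3_tangle : tangle [::] c3 :=
  of_strings [::] c3 [:: (0, 0) -- (0, 5); (0, 1) -- (0, 4); (0, 2) -- (0, 3)].
Definition id2 : P c2 := act P id2_tangle tt.
Definition id3 : P c3 := act P id3_tangle tt.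

Lemma mul2A (x y z : P c2) : mul x (mul y z) = mul (mul x y) z.
Proof.
rewrite /mul.
transitivity (act P (glue (cs := [:: c2]) (ds := [::]) (mul_tangle c2)
  (mul_tangle c2)) (x, (y, (z, tt)))).
  by apply: (@act_subst [:: c2] [::] [:: c2; c2] c2 c2 _ _ _ (x, tt) tt
    (y, (z, tt))); vm_compute.
by symmetry; apply: (@act_subst [::] [:: c2] [:: c2; c2] c2 c2 _ _ _ tt (z, tt)
  (x, (y, tt))); vm_compute.
Qed.

Lemma mul_id2l (x : P c2) : mul id2 x = x.
Proof.
rewrite -[RHS](act_id HP).
by apply: (@act_subst [::] [:: c2] [::] c2 c2 _ _ _ tt (x, tt) tt); vm_compute.
Qed.

Lemma mul_id3l (x : P c3) : mul id3 x = x.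
Proof.
rewrite -[RHS](act_id HP).
by apply: (@act_subst [::] [:: c3] [::] c3 c3 _ _ _ tt (x, tt) tt); vm_compute.
Qed.

Lemma mul_id3r (x : P c3) : mul x id3 = x.
Proof.
rewrite -[RHS](act_id HP).
by apply: (@act_subst [:: c3] [::] [::] c3 c3 _ _ _ (x, tt) tt tt); vm_compute.
Qed.

Lemma tens_id_id2 : tens_id id2 = id3.
Proof.
by apply: (@act_subst [::] [::] [::] c2 c3 _ _ _ tt tt tt); vm_compute.
Qed.

Lemma id_tens_fourier_id2 : id_tens_fourier id2 = U3 P.
Proof.
by apply: (@act_subst [::] [::] [::] c2 c3 _ _ _ tt tt tt); vm_compute.
Qed.

Lemma tens_idM (x y : P c2) : mul (tens_id x) (tens_id y) = tens_id (mul x y).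
Proof.
rewrite /mul /tens_id.
set T1 : tangle [:: c2] c3 := of_strings _ _ _.
transitivity (act P (glue (cs := [::]) (ds := [::]) T1 (mul_tangle c2))
  (x, (y, tt))).
  etransitivity.
    by apply: (@act_glueE [::] [:: c3] [:: c2] c3 c3 _ _ tt
      (act P T1 (y, tt), tt) (x, tt)); vm_compute.
  by apply: (@act_subst [:: c2] [::] [:: c2] c3 c3 _ _ _ (x, tt) tt (y, tt));
    vm_compute.
by symmetry; apply: (@act_subst [::] [::] [:: c2; c2] c2 c3 _ _ _ tt tt
  (x, (y, tt))); vm_compute.
Qed.

(** Three 2-boxes joined pairwise by one string, the 3-box [P_x Q_y P_z]. *)
Definition triangle_tangle : tangle [:: c2; c2; c2] c3 :=
  of_strings [:: c2; c2; c2] c3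
    [:: (0, 0) -- (1, 0); (0, 1) -- (1, 1); (0, 2) -- (2, 2); (0, 3) -- (2, 3);
     (0, 4) -- (3, 2); (0, 5) -- (3, 3);
     (1, 3) -- (3, 0); (1, 2) -- (2, 1); (2, 0) -- (3, 1)].
Definition triangle (x y z : P c2) : P c3 :=
  act P triangle_tangle (x, (y, (z, tt))).

Lemma triangleE (x y z : P c2) :
  mul (mul (tens_id x) (id_tens_fourier y)) (tens_id z) = triangle x y z.
Proof.
rewrite mul3_mulE /tens_id /id_tens_fourier.
etransitivity.
  by apply: (@act_glueE [::] [:: c3; c3] [:: c2] c3 c3 _ _ tt (_, (_, tt))
    (x, tt)); vm_compute.
etransitivity.
  by apply: (@act_glueE [:: c2] [:: c3] [:: c2] c3 c3 _ _ (x, tt) (_, tt)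
    (y, tt)); vm_compute.
by apply: (@act_subst [:: c2; c2] [::] [:: c2] c3 c3 _ _ _ (x, (y, tt)) tt
  (z, tt)); vm_compute.
Qed.

(** Stacks [w] under the middle 2-box [y] of a triangle: this 2-box is turned by
   90 degrees, so that its lower points are the points 2 and 3 on the right of
   the 3-box. *)
Definition attach_below (t : P c3) (w : P c2) : P c3 :=
  act P (of_strings [:: c3; c2] c3
    [:: (0, 0) -- (1, 0); (0, 1) -- (1, 1); (0, 4) -- (1, 4); (0, 5) -- (1, 5);
     (1, 2) -- (2, 1); (1, 3) -- (2, 0); (0, 2) -- (2, 2); (0, 3) -- (2, 3)])
    (t, (w, tt)).

Lemma attach_triangle (x y z w : P c2) : attach_below (triangle x y z) w =
  triangle x (mul y w) z.
Proof.
rewrite /attach_below /triangle.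
set T1 : tangle [:: c3; c2] c3 := of_strings _ _ _.
set T2 := triangle_tangle.
pose R : tangle [:: c2; c2; c2; c2] c3 :=
  glue (cs := [:: c2]) (ds := [:: c2]) T2 (mul_tangle c2).
transitivity (act P R (x, (y, (w, (z, tt))))); last first.
  by symmetry; apply: (@act_glueE [:: c2] [:: c2] [:: c2; c2] c2 c3 _ _ (x, tt)
    (z, tt) (y, (w, tt))); vm_compute.
transitivity (act P (glue (cs := [::]) (ds := [:: c2]) T1 T2)
  (x, (y, (z, (w, tt))))).
  by apply: (@act_glueE [::] [:: c2] [:: c2; c2; c2] c3 c3 _ _ tt (w, tt)
    (x, (y, (z, tt)))); vm_compute.
rewrite -(@act_swap _ _ HP [:: c2; c2] [::] c2 c2 c3 R (x, (y, tt)) tt w z);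
  last by vm_compute.
by apply: (act_isotopic HP); vm_compute.
Qed.

(** Three 2-boxes joined pairwise by two strings, on the sphere. *)
Definition theta (x y z : P c2) : P (0%N, true) :=
  act P (of_strings [:: c2; c2; c2] (0%N, true)
   [:: (1, 3) -- (3, 0); (1, 2) -- (2, 1); (3, 1) -- (2, 0);
    (3, 2) -- (2, 3); (1, 0) -- (3, 3); (1, 1) -- (2, 2)]) (x, (y, (z, tt))).

Lemma pairing_conv (x y z : P c2) :
  act P (pairing_tangle c2) (x, (conv z y, tt)) = theta x y z.
Proof.
rewrite /theta /conv.
set T1 : tangle [:: c2; c2] c2 := of_strings _ _ _.
set T2 : tangle [:: c2; c2; c2] (0%N, true) := of_strings _ _ _.
rewrite -(@act_swap _ _ HP [:: c2] [::] c2 c2 _ T2 (x, tt) tt y z);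
  last by vm_compute.
by apply: (@act_subst [:: c2] [::] [:: c2; c2] c2 _ _ _ _ (x, tt) tt
  (z, (y, tt))); vm_compute.
Qed.

(** Gluing a triangle to its mirror image identifies the outer points of each
   2-box with those of its mirror image. *)
Lemma pairing_triangle (x y z x' y' z' : P c2) :
  act P (pairing_tangle c3)
    (triangle x y z, (act P (reflect_tangle triangle_tangle)
      (x', (y', (z', tt))), tt)) =
  theta (mul x' x) (mul y y') (mul z z').
Proof.
rewrite /theta /mul /triangle.
set T1 := triangle_tangle.
set T2 : tangle [:: c2; c2; c2] (0%N, true) := of_strings _ _ _.
symmetry.
etransitivity.
  by apply: (@act_glueE [::] [:: c2; c2] [:: c2; c2] c2 _ _ _ tt (_, (_, tt))
    (x', (x, tt))); vm_compute.
etransitivity.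
  by apply: (@act_glueE [:: c2; c2] [:: c2] [:: c2; c2] c2 _ _ _ (x', (x, tt))
    (_, tt) (y, (y', tt))); vm_compute.
etransitivity.
  by apply: (@act_glueE [:: c2; c2; c2; c2] [::] [:: c2; c2] c2 _ _ _
    (x', (x, (y, (y', tt)))) tt (z, (z', tt))); vm_compute.
(* The inputs come in the order [x', x, y, y', z, z'] and are rearranged as
   [x, y, z, x', y', z']. *)
etransitivity.
  by apply: (@act_swapE [:: c2; c2; c2] [:: c2] c2 c2 _ _ (x', (x, (y, tt)))
    (z', tt) y' z); vm_compute.
etransitivity.
  by apply: (@act_swapE [::] [:: c2; c2; c2; c2] c2 c2 _ _ tt
    (y, (z, (y', (z', tt)))) x' x); vm_compute.
etransitivity.
  by apply: (@act_swapE [:: c2] [:: c2; c2; c2] c2 c2 _ _ (x, tt)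
    (z, (y', (z', tt))) x' y); vm_compute.
etransitivity.
  by apply: (@act_swapE [:: c2; c2] [:: c2; c2] c2 c2 _ _ (x, (y, tt))
    (y', (z', tt)) x' z); vm_compute.
symmetry.
etransitivity.
  by apply: (@act_glueE [::] [:: c3] [:: c2; c2; c2] c3 _ _ _ tt (_, tt)
    (x, (y, (z, tt)))); vm_compute.
by apply: (@act_subst [:: c2; c2; c2] [::] [:: c2; c2; c2] c3 _ _ _ _
  (x, (y, (z, tt))) tt (x', (y', (z', tt)))); vm_compute.
Qed.

Definition trace (x : P c2) : P (0%N, true) :=
  act P (of_strings [:: c2] (0%N, true)
    [:: (1, 0) -- (1, 3); (1, 1) -- (1, 2)]) (x, tt).

Lemma pairing_mul (x y : P c2) :
  act P (pairing_tangle c2) (x, (y, tt)) = trace (mul x y).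
Proof.
by symmetry; apply: (@act_subst [::] [::] [:: c2; c2] c2 _ _ _ _ tt tt
  (x, (y, tt))); vm_compute.
Qed.

(** The empty diagram is a unit for the gluing of 0-boxes: if it vanished, so
   would the identity tangle. *)
Lemma empty_neq0 e : act P (empty_tangle e) tt != 0.
Proof.
have [x x_neq0] : exists x : P (0%N, e), x != 0.
  have : \dim {:P (0%N, e)} != 0%N by rewrite (space0 HP).
  by rewrite dimv_eq0 -vpick0; exists (vpick {:P (0%N, e)}).
apply: contraNneq x_neq0 => empty0; rewrite -(act_id HP x).
have <- : act P (pairing_tangle (0%N, e)) (x, (act P (empty_tangle e) tt, tt)) =
    act P (id_tangle (0%N, e)) (x, tt).
  apply: (@act_subst [:: (0%N, e)] [::] [::] (0%N, e) (0%N, e) _ _ _ (x, tt) tt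
    tt).
  by case: (e); vm_compute.
rewrite empty0.
have := @act_linear _ _ HP [:: (0%N, e)] [::] (0%N, e) _
  (pairing_tangle (0%N, e)) (x, tt) tt (-1) 0 0.
rewrite scaler0 addr0 scaleN1r addNr => -> //.
Qed.

Lemma star_mul (x y : P c2) : star P (mul x y) = mul (star P y) (star P x).
Proof.
rewrite (act_star HP); last by vm_compute.
rewrite /imap /=.
etransitivity.
  by apply: (@act_swapE [::] [::] c2 c2 _ _ tt tt _ _); vm_compute.
by apply: (act_isotopic HP); vm_compute.
Qed.
End Diagrams.

(** * Bridges and forests *)

Definition del_edge (T : eqType) (e : rel T) (u v : T) : rel T :=
  fun x y => [&& e x y, (x, y) != (u, v) & (x, y) != (v, u)].

Lemma del_edge_sym (T : eqType) (e : rel T) (u v : T) :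
  symmetric e -> symmetric (del_edge e u v).
Proof.
by move=> e_sym x y; rewrite /del_edge e_sym !xpair_eqE (andbC (y == u))
  (andbC (y == v)); congr andb; rewrite andbC.
Qed.

(** A path that avoids the edge [u -- v] would close up to a cycle. *)
Lemma forest_disconnects (T : finType) (e : rel T) (u v : T) :
  symmetric e -> is_forest e -> e u v -> u != v ->
  ~~ connect (del_edge e u v) u v.
Proof.
move=> e_sym forest_e euv neq_uv; apply/negP=>
  /connectP[q0 /shortenP[q path_q uniq_q _] def_v].
case: q path_q uniq_q def_v => [|x [|y q]] path_q uniq_q def_v.
- by rewrite def_v eqxx in neq_uv.
- by move: path_q; rewrite /= /del_edge def_v eqxx /= andbF.
have /negP[] := forest_e [:: u, x, y & q] isT.
rewrite /ucycleb uniq_q andbT /cycle rcons_path; apply/andP; split;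
  last by rewrite -def_v e_sym.
by apply: sub_path path_q => a b /and3P[].
Qed.

(** Along a cycle through [u -- v] a potential is constant on all the other
   edges, which join [v] to [u]. *)
Lemma potential_forest (T : finType) (e : rel T) (X : Type) :
  (forall u v, e u v -> exists2 f : T -> X, f u <> f v &
     forall x y, del_edge e u v x y -> f x = f y) ->
  is_forest e.
Proof.
move=> pot [|u [|v [|w c]]] // _; apply/negP=>
  /andP[/= /andP[euv /andP[evw path_c]]].
rewrite inE negb_or => /and3P[/andP[neq_uv u_notin] v_notin _].
have [f f_neq f_eq] := pot u v euv; apply: f_neq.
have f_path z : forall s, u \notin z :: s -> v \notin z :: s ->
    path e z (rcons s u) -> f z = f u.
  move=> s; elim: s z => [|z' s IHs] z /=.
    rewrite !inE => neq_uz neq_vz; rewrite andbT => ezu; apply: f_eq.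
    by rewrite /del_edge ezu !xpair_eqE (eq_sym z) (negPf neq_uz) (eq_sym z)
      (negPf neq_vz).
  rewrite inE negb_or => /andP[neq_uz u_s]; rewrite inE negb_or =>
    /andP[neq_vz v_s].
  case/andP=> ezz' path_s; rewrite (f_eq z z') ?IHs // /del_edge ezz'
    !xpair_eqE.
  by rewrite (eq_sym z) (negPf neq_uz) (eq_sym z) (negPf neq_vz).
rewrite -(f_path w c) //; apply: esym; apply: f_eq;
  rewrite /del_edge evw !xpair_eqE.
rewrite (eq_sym v) (negPf neq_uv) /=.
by move: u_notin; rewrite inE negb_or eq_sym => /andP[/negPf->]; rewrite andbF.
Qed.

Section Graph.
Variables (C : numClosedFieldType) (n : nat) (B : fusionBialgebra C n).
Implicit Types i j s l k : 'I_n.+1.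

Lemma fusion_graph_sym k : symmetric (fusion_graph B k).
Proof. by case=> x [] y. Qed.

(** [a] on white vertices together with [- b] on black ones is a potential that
   drops along [(i, j)] only.  If this edge is a bridge, the indicator function
   of the component of [i] in the complement is such a potential. *)
Lemma fusion_forestP k :
  is_forest (fusion_graph B k) <->
  forall i j, exists a b : 'I_n.+1 -> C, forall s l,
    fb_coef B k l s != 0 -> ((s == i) && (l == j))%:R = a s + b l.
Proof.
split=> [forest_k i j | pot].
  case: (boolP (fusion_graph B k (inl i) (inr j))) => [eij | /negPf nij];
    last first.
    exists (fun=> 0), (fun=> 0) => s l sl; rewrite addr0.
    by case: eqP => // si; case: eqP => // lj; move: nij; rewrite /= -si -lj sl.
  set e' := del_edge (fusion_graph B k) (inl i) (inr j).
  have := forest_disconnects (fusion_graph_sym k) forest_k eij isT.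
  rewrite -/e' => ncij; set f := fun x => (connect e' (inl i) x)%:R : C.
  have sym_e' : connect_sym e' by apply: sym_connect_sym; apply: del_edge_sym;
    apply: fusion_graph_sym.
  exists (fun s => f (inl s)), (fun l => - f (inr l)) => s l sl; rewrite /f.
  case: (boolP ((s == i) && (l == j))) => [/andP[/eqP-> /eqP->] | nij].
    by rewrite connect0 (negPf ncij) subr0.
  apply/eqP; rewrite eq_sym subr_eq0; apply/eqP; congr (nat_of_bool _)%:R.
  apply: (same_connect_r sym_e'); apply: connect1.
  by apply/and3P; split=> //; apply: contra nij => /eqP[-> ->]; rewrite !eqxx.
have potE u v : fusion_graph B k u v -> exists2 f : 'I_n.+1 + 'I_n.+1 -> C,
    f u <> f v & forall x y, del_edge (fusion_graph B k) u v x y -> f x = f y.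
  wlog: u v / exists i j, u = inl i /\ v = inr j.
    move=> IH; case: u v => [i | j] [i' | j'] // euv; first by apply: IH => //;
      exists i, j'.
    case: (IH (inl i') (inr j)) => //; first by exists i', j.
    by move=> f f_neq f_eq; exists f => [/esym // | x y xy]; apply: f_eq;
      move: xy; rewrite /del_edge andbA andbAC -andbA.
  case=> i [j [-> ->]] /= eij; have [a [b ab]] := pot i j.
  exists (fun x => match x with inl s => a s | inr l => - b l end).
    apply/eqP; rewrite -subr_eq0 opprK -ab // !eqxx; exact: oner_neq0.
  have abE s l : fb_coef B k l s != 0 -> ~~ ((s == i) && (l == j)) ->
      a s = - b l.
    by move=> sl /negPf nij; apply/eqP; rewrite -subr_eq0 opprK -ab // nij.
  case=> [s | l] [s' | l'] /and3P[//= sl n1 n2].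
    by apply: abE => //; apply: contra n1 => /andP[/eqP-> /eqP->].
  by symmetry; apply: abE => //; apply: contra n2 => /andP[/eqP-> /eqP->].
exact: potential_forest potE.
Qed.

End Graph.

(** * The exchange relation in the corners *)

(** Planar operations are linear by an axiom of planar algebras and carry no
   canonical linear structure, hence these consequences of the axiom for an
   arbitrary function. *)
Section Linear.
Variables (C : numClosedFieldType) (U V : lmodType C) (f : U -> V).
Hypothesis f_lin : forall a x y, f (a *: x + y) = a *: f x + f y.
Lemma lin0 : f 0 = 0.
Proof. by have := f_lin (-1) 0 0; rewrite scaler0 addr0 scaleN1r addNr. Qed.
Lemma linD x y : f (x + y) = f x + f y.
Proof. by have := f_lin 1 x y; rewrite !scale1r. Qed.
Lemma linZ a x : f (a *: x) = a *: f x.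
Proof. by have := f_lin a x 0; rewrite lin0 !addr0. Qed.
Lemma lin_sum (I : finType) (F : I -> U) : f (\sum_i F i) = \sum_i f (F i).
Proof. by apply: (big_morph f linD lin0). Qed.
End Linear.

Section Boxes.
Variables (C : numClosedFieldType) (P : planarData C).
Hypothesis HP : is_subfactor_planar_algebra P.
Notation inp := (inputs (fun c => P c)).

Lemma mul3_linl (z : P c3) a (x y : P c3) :
  mul (a *: x + y) z = a *: mul x z + mul y z.
Proof.
by apply: (act_linear HP (cs := [::]) (ds := [:: c3]) tt (z, tt)); vm_compute.
Qed.
Lemma mul3_linr (z : P c3) a (x y : P c3) :
  mul z (a *: x + y) = a *: mul z x + mul z y.
Proof.
by apply: (act_linear HP (cs := [:: c3]) (ds := [::]) (z, tt) tt); vm_compute.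
Qed.
Lemma mul2_linl (z : P c2) a (x y : P c2) :
  mul (a *: x + y) z = a *: mul x z + mul y z.
Proof.
by apply: (act_linear HP (cs := [::]) (ds := [:: c2]) tt (z, tt)); vm_compute.
Qed.
Lemma mul2_linr (z : P c2) a (x y : P c2) :
  mul z (a *: x + y) = a *: mul z x + mul z y.
Proof.
by apply: (act_linear HP (cs := [:: c2]) (ds := [::]) (z, tt) tt); vm_compute.
Qed.
Lemma tens_id_lin a (x y : P c2) : tens_id (a *: x + y) =
  a *: tens_id x + tens_id y.
Proof.
by apply: (act_linear HP (cs := [::]) (ds := [::]) tt tt); vm_compute.
Qed.
Lemma id_tens_fourier_lin a (x y : P c2) :
  id_tens_fourier (a *: x + y) = a *: id_tens_fourier x + id_tens_fourier y.
Proof.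
by apply: (act_linear HP (cs := [::]) (ds := [::]) tt tt); vm_compute.
Qed.
Lemma attach_below_lin (w : P c2) a (x y : P c3) :
  attach_below (a *: x + y) w = a *: attach_below x w + attach_below y w.
Proof.
by apply: (act_linear HP (cs := [::]) (ds := [:: c2]) tt (w, tt)); vm_compute.
Qed.
Lemma triangle_lin (x z : P c2) a (y y' : P c2) :
  triangle x (a *: y + y') z = a *: triangle x y z + triangle x y' z.
Proof.
by apply: (act_linear HP (cs := [:: c2]) (ds := [:: c2]) (x, tt) (z, tt));
  vm_compute.
Qed.
Lemma conv_linl (z : P c2) a (x y : P c2) :
  conv (a *: x + y) z = a *: conv x z + conv y z.
Proof.
by apply: (act_linear HP (cs := [::]) (ds := [:: c2]) tt (z, tt)); vm_compute.
Qed.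
Lemma conv_linr (z : P c2) a (x y : P c2) :
  conv z (a *: x + y) = a *: conv z x + conv z y.
Proof.
by apply: (act_linear HP (cs := [:: c2]) (ds := [::]) (z, tt) tt); vm_compute.
Qed.
Lemma trace_lin a (x y : P c2) : trace (a *: x + y) = a *: trace x + trace y.
Proof.
by apply: (act_linear HP (cs := [::]) (ds := [::]) tt tt); vm_compute.
Qed.
Lemma pairing3_lin (z : P c3) a (x y : P c3) :
  act P (pairing_tangle c3) (a *: x + y, (z, tt)) =
  a *: act P (pairing_tangle c3) (x, (z, tt)) +
  act P (pairing_tangle c3) (y, (z, tt)).
Proof.
by apply: (act_linear HP (cs := [::]) (ds := [:: c3]) tt (z, tt)); vm_compute.
Qed.

Section Exchange.
Variables (n : nat) (p : 'I_n.+1 -> P c2).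
Hypothesis pM : forall i j, mul (p i) (p j) = (i == j)%:R *: p i.
Hypothesis p1 : \sum_i p i = id2 P.
Implicit Types i j s l m : 'I_n.+1.

Definition box_triangle s l m := triangle (p s) (p l) (p m).
Definition corner s m (X : P c3) := mul (mul (tens_id (p s)) X) (tens_id (p m)).

Lemma corner_lin s m a X Y : corner s m (a *: X + Y) =
  a *: corner s m X + corner s m Y.
Proof. by rewrite /corner mul3_linr mul3_linl. Qed.

Lemma tens_p_ortho i j : mul (tens_id (p i)) (tens_id (p j)) =
  (i == j)%:R *: tens_id (p i).
Proof. by rewrite (tens_idM HP) pM (linZ tens_id_lin). Qed.

(** Peirce decomposition with respect to the idempotents [P_s]. *)
Lemma sum_corner X : \sum_s \sum_m corner s m X = X.
Proof.
have sum_tens : \sum_i tens_id (p i) = id3 P.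
  by rewrite -(lin_sum tens_id_lin) p1 (tens_id_id2 HP).
under eq_bigr => s _ do rewrite -(lin_sum (mul3_linr _)) sum_tens (mul_id3r HP).
by rewrite -(lin_sum (fun a x y => mul3_linl X a x y)) sum_tens (mul_id3l HP).
Qed.

Lemma corner_E1 s m i j : corner s m (E1 p i j) =
  (s == i)%:R *: box_triangle s j m.
Proof.
rewrite /corner /E1 (mul3A HP) tens_p_ortho !(linZ (mul3_linl _));
  congr (_ *: _).
exact: (triangleE HP).
Qed.

Lemma corner_E2 s m s' t :
  corner s m (E2 p s' t) =
  ((s == s') && (t == m))%:R *: \sum_l box_triangle s l m.
Proof.
rewrite /corner /E2 !(mul3A HP) tens_p_ortho !(linZ (mul3_linl _))
  -(mul3A HP _ (tens_id (p t))).
rewrite tens_p_ortho (linZ (mul3_linr _)) scalerA -natrM mulnb.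
have [<- | _] := eqVneq t m; last by rewrite andbF !scale0r.
congr (_ *: _); rewrite -(id_tens_fourier_id2 HP) (triangleE HP) -p1.
exact: (lin_sum (triangle_lin _ _)).
Qed.

Lemma corner_E3 s m l t : corner s m (E3 p l t) =
  (t == m)%:R *: box_triangle s l m.
Proof.
rewrite /corner /E3 (mul3A HP) -(mul3A HP) tens_p_ortho (linZ (mul3_linr _))
  (triangleE HP).
by have [<- | _] := eqVneq t m; rewrite ?scale0r.
Qed.

Lemma attach_box_triangle s l m l' : attach_below (box_triangle s l m) (p l') =
  (l == l')%:R *: box_triangle s l m.
Proof.
by rewrite /box_triangle (attach_triangle HP) pM (linZ (triangle_lin _ _)).
Qed.

(** In a corner only one [E2] and the [E3] of one column survive, and the [E2]
   is the sum of all triangles because the [p l] sum to the identity. *)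
Lemma corner_exchange s m (a b : 'I_n.+1 -> 'I_n.+1 -> C) :
  corner s m (\sum_s \sum_t a s t *: E2 p s t +
              \sum_l \sum_m b l m *: E3 p l m) =
  \sum_l (a s m + b l m) *: box_triangle s l m.
Proof.
rewrite (linD (corner_lin s m)) !(lin_sum (corner_lin s m)).
under eq_bigr => s' _ do rewrite (lin_sum (corner_lin s m)).
under [in X in _ + X]eq_bigr => l _ do rewrite (lin_sum (corner_lin s m)).
under [RHS]eq_bigr => l _ do rewrite scalerDl.
rewrite big_split /=; congr (_ + _).
  rewrite (bigD1 s) //= [X in _ + X]big1 ?addr0; last first.
    move=> s' neq_s; apply: big1 => t _.
    by rewrite (linZ (corner_lin s m)) corner_E2 eq_sym (negPf neq_s) scale0r
      scaler0.
  rewrite (bigD1 m) //= [X in _ + X]big1 ?addr0; last first.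
    move=> t neq_t.
    by rewrite (linZ (corner_lin s m)) corner_E2 (negPf neq_t) andbF scale0r
      scaler0.
  by rewrite (linZ (corner_lin s m)) corner_E2 !eqxx scale1r scaler_sumr.
apply: eq_bigr => l _; rewrite (bigD1 m) //= [X in _ + X]big1 ?addr0;
  last first.
  move=> t neq_t.
  by rewrite (linZ (corner_lin s m)) corner_E3 (negPf neq_t) scale0r scaler0.
by rewrite (linZ (corner_lin s m)) corner_E3 eqxx scale1r.
Qed.

(** For fixed [s] and [m] the nonzero triangles are linearly independent, since
   [attach_below] separates them; so the relation in the corner [(s, m)] can be
   read coefficientwise. *)
Lemma exchangeP :
  (exists a b : 'I_n.+1 -> 'I_n.+1 -> 'I_n.+1 -> 'I_n.+1 -> C,
    forall i j, E1 p i j =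
      \sum_s \sum_t a i j s t *: E2 p s t +
      \sum_l \sum_m b i j l m *: E3 p l m) <->
  (forall m i j, exists a b : 'I_n.+1 -> C, forall s l,
     box_triangle s l m != 0 -> ((s == i) && (l == j))%:R = a s + b l).
Proof.
split=> [[a [b ab]] m i j | pot].
  exists (fun s => a i j s m), (fun l => b i j l m) => s l t_neq0.
  have := congr1 (fun X => attach_below (corner s m X) (p l)) (ab i j).
  rewrite /= corner_exchange corner_E1 (linZ (attach_below_lin _))
    attach_box_triangle.
  rewrite (lin_sum (attach_below_lin _)) (bigD1 l) //= [X in _ + X]big1 ?addr0;
    last first.
    move=> l' neq_l.
    by rewrite (linZ (attach_below_lin _)) attach_box_triangle (negPf neq_l)
      scale0r scaler0.
  rewrite (linZ (attach_below_lin _)) attach_box_triangle eqxx scale1r scalerA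
    -natrM mulnb eq_sym (eq_sym j).
  have [<- | neq_l] := eqVneq l j.
    by rewrite eq_sym => /eqP; rewrite -subr_eq0 -scalerBl scaler_eq0
      (negPf t_neq0) orbF subr_eq0 => /eqP.
  rewrite !andbF scale0r => /esym/eqP.
  by rewrite scaler_eq0 (negPf t_neq0) orbF => /eqP->.
have [ab abE] := fin_all_exists
  (fun m => fin_all_exists (fun i => fin_all_exists (pot m i))).
have [b {}abE] := fin_all_exists
  (fun m => fin_all_exists (fun i => fin_all_exists (abE m i))).
exists (fun i j s m => ab m i j s), (fun i j l m => b m i j l) => i j.
rewrite -[LHS]sum_corner -[RHS]sum_corner; apply: eq_bigr => s _;
  apply: eq_bigr => m _.
rewrite corner_exchange corner_E1.
transitivity (\sum_l ((s == i) && (l == j))%:R *: box_triangle s l m).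
  rewrite (bigD1 j) //= eqxx andbT big1 ?addr0 // => l /negPf->.
  by rewrite andbF scale0r.
apply: eq_bigr => l _; have [-> | t_neq0] := eqVneq (box_triangle s l m) 0.
  by rewrite !scaler0.
by rewrite (abE m i j).
Qed.
End Exchange.
End Boxes.

(** * Adjacency in the fusion graphs *)

Section Projections.
Variables (C : numClosedFieldType) (P : planarData C) (n : nat).
Variables (p : 'I_n.+1 -> P c2).
Hypothesis pP : is_abelian_with p.
Let HP := aw_subfactor pP.
Implicit Types i j s l m : 'I_n.+1.

Lemma min_proj i : is_minimal_projection (p i).
Proof. by apply/(aw_minimal pP); exists i. Qed.

Lemma p_neq0 i : p i != 0.
Proof. by case: (min_proj i). Qed.
Lemma p_idem i : mul (p i) (p i) = p i.
Proof.
by case: (min_proj i) => [[]].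
Qed.
Lemma p_star i : star P (p i) = p i.
Proof. by case: (min_proj i) => [[]]. Qed.

(** In a commutative algebra [p_i p_j] is a projection below both [p_i] and
   [p_j], which are minimal. *)
Lemma p_ortho i j : mul (p i) (p j) = (i == j)%:R *: p i.
Proof.
have [<- | neq_ij] := eqVneq i j; first by rewrite scale1r p_idem.
rewrite scale0r; set q := mul (p i) (p j).
have qC : q = mul (p j) (p i) by rewrite /q (aw_comm pP).
have iq : mul (p i) q = q by rewrite /q (mul2A HP) p_idem.
have jq : mul (p j) q = q by rewrite qC (mul2A HP) p_idem.
have q_proj : is_projection q.
  split; first by rewrite {1}/q -(mul2A HP) jq iq.
  by rewrite /q (star_mul HP) !p_star -qC.
case: (min_proj i) => _ _ /(_ q q_proj iq); rewrite (aw_comm pP) =>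
  /(_ iq) [// | qi].
case: (min_proj j) => _ _ /(_ q q_proj jq); rewrite (aw_comm pP) =>
  /(_ jq) [// | qj].
by case/eqP: neq_ij; apply: (aw_inj pP); rewrite -qi -qj.
Qed.

(** Multiplying an expansion of the identity by [p_j] shows that its
   coefficients are 1. *)
Lemma sum_p : (forall x, exists c : 'I_n.+1 -> C, x = \sum_i c i *: p i) ->
  \sum_i p i = id2 P.
Proof.
move=> /(_ (id2 P))[c id2E]; rewrite id2E; apply: eq_bigr => j _.
have := mul_id2l HP (p j); rewrite {1}id2E
  (lin_sum (fun a x y => mul2_linl HP (p j) a x y)).
rewrite (bigD1 j) //= (linZ (mul2_linl HP _)) p_idem big1 ?addr0 // => i neq_ij.
by rewrite (linZ (mul2_linl HP _)) p_ortho (negPf neq_ij) scale0r scaler0.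
Qed.

Lemma trace_p_neq0 i : trace (p i) != 0.
Proof.
have [s s_gt0] := inner_prod_gt0 HP (p_neq0 i).
rewrite p_star (pairing_mul HP) p_idem => ->.
by rewrite scaler_eq0 (gt_eqF s_gt0) (negPf (empty_neq0 HP _)).
Qed.

(** [theta] is the square norm of the triangle, by idempotence of the
   projections. *)
Lemma box_triangle_theta s l m : (box_triangle p s l m != 0) =
  (theta (p s) (p l) (p m) != 0).
Proof.
have star_triangle : star P (box_triangle p s l m) =
  act P (reflect_tangle triangle_tangle) (p s, (p l, (p m, tt))).
  rewrite /box_triangle /triangle (act_star HP); last by vm_compute.
  by rewrite /imap /= !p_star.
have := pairing_triangle HP (p s) (p l) (p m) (p s) (p l) (p m).
rewrite -star_triangle !p_idem -/(box_triangle p s l m) => <-.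
apply/idP/idP => [t_neq0 | ].
  have [r r_gt0 ->] := inner_prod_gt0 HP t_neq0.
  by rewrite scaler_eq0 (gt_eqF r_gt0) (negPf (empty_neq0 HP _)).
by apply: contraNneq => ->; rewrite (lin0 (pairing3_lin HP _)).
Qed.

Variable B : fusionBialgebra C n.
Variables (d : 'I_n.+1 -> C) (phi : {linear B -> P c2}).
Hypothesis phi_bij : bijective phi.
Hypothesis phiM : forall x y, phi (x * y) = conv (phi x) (phi y).
Hypothesis phi_x : forall j, phi (tnth (fb_x B) j) =
  sqrtC (delta P / d j) *: p j.

(** Otherwise [phi] would send a basis vector to 0.  This rules out the
   degenerate values of the square root without computing [d_j]. *)
Lemma phi_coef_neq0 j : sqrtC (delta P / d j) != 0.
Proof.
apply: contraTneq (isT) => c0; have := phi_x j; rewrite c0 scale0r => phi0.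
have : tnth (fb_x B) j = 0 by apply: (bij_inj phi_bij); rewrite phi0 linear0.
have /free_not0/(_ (mem_tnth j _)) := basis_free (fb_basis B).
by move=> /[swap] ->; rewrite eqxx.
Qed.

Lemma coord_fb_x (x : B) : x = \sum_i coord (fb_x B) i x *: tnth (fb_x B) i.
Proof.
rewrite {1}(coord_basis (fb_basis B) (memvf x)).
by apply: eq_bigr => i _; rewrite (tnth_nth 0).
Qed.

Lemma p_span x : exists c : 'I_n.+1 -> C, x = \sum_i c i *: p i.
Proof.
have [g _ phiK] := phi_bij.
exists (fun i => coord (fb_x B) i (g x) * sqrtC (delta P / d i)).
rewrite -{1}[x]phiK {1}(coord_fb_x (g x)) linear_sum; apply: eq_bigr => i _.
by rewrite linearZ /= phi_x scalerA.
Qed.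

(** [theta] is also the trace of [p_s (p_m * p_l)], which is the coefficient of
   [p_s] in [p_m * p_l] times the nonzero trace of [p_s]. *)
Lemma box_triangle_coef s l m : (box_triangle p s l m != 0) =
  (fb_coef B m l s != 0).
Proof.
rewrite box_triangle_theta -(pairing_conv HP) (pairing_mul HP).
set c := fun j => sqrtC (delta P / d j).
have c_neq0 j : c j != 0 by apply: phi_coef_neq0.
have conv_p :
    c m * c l *: conv (p m) (p l) = \sum_i fb_coef B m l i * c i *: p i.
  transitivity (phi (tnth (fb_x B) m * tnth (fb_x B) l)).
    rewrite phiM !phi_x (linZ (fun a x y => conv_linl HP _ a x y)).
    by rewrite (linZ (fun a x y => conv_linr HP _ a x y)) scalerA.
  rewrite (coord_fb_x (_ * _)) linear_sum; apply: eq_bigr => i _.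
  by rewrite linearZ /= phi_x scalerA.
have : c m * c l *: mul (p s) (conv (p m) (p l)) = fb_coef B m l s * c s *: p s.
  rewrite -(linZ (fun a x y => mul2_linr HP _ a x y)) conv_p.
  rewrite (lin_sum (fun a x y => mul2_linr HP _ a x y)) (bigD1 s) //=.
  rewrite (linZ (fun a x y => mul2_linr HP _ a x y)) p_idem big1 ?addr0 // =>
    i neq_i.
  by rewrite (linZ (fun a x y => mul2_linr HP _ a x y)) p_ortho eq_sym
    (negPf neq_i) scale0r scaler0.
move=> /(congr1 (@trace _ P)); rewrite !(linZ (trace_lin HP)) =>
  /(congr1 (fun x => x == 0)).
rewrite !scaler_eq0 !mulf_eq0 !(negPf (c_neq0 _)) (negPf (trace_p_neq0 _)) /=
  !orbF.
by move=> ->.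
Qed.
End Projections.

(** Which triangles vanish depends on the structure constants of [B] only. *)
Lemma exchange_forest (C : numClosedFieldType) (n : nat) (P : planarData C)
    (p : 'I_n.+1 -> P c2) (B : fusionBialgebra C n) :
  realizes p B ->
  (exists a b : 'I_n.+1 -> 'I_n.+1 -> 'I_n.+1 -> 'I_n.+1 -> C,
    forall i j, E1 p i j =
      \sum_s \sum_t a i j s t *: E2 p s t +
      \sum_l \sum_m b i j l m *: E3 p l m) <->
  (forall k, is_forest (fusion_graph B k)).
Proof.
case=> pP [d [phi [_ phi_bij phiM phi_x _]]]; have HP := aw_subfactor pP.
have sum_p := sum_p pP (p_span phi_bij phi_x).
rewrite (exchangeP HP (p_ortho pP) sum_p).
have TE := box_triangle_coef pP phi_bij phiM phi_x.
split=> [pot k | forest m i j].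
  by apply/fusion_forestP => i j; have [a [b ab]] := pot k i j; exists a, b =>
    s l; rewrite -TE; apply: ab.
have [a [b ab]] := (fusion_forestP B m).1 (forest m) i j.
by exists a, b => s l; rewrite TE; apply: ab.
Qed.

(** * The planar subalgebra generated by the 2-boxes *)

Section Families.
Variables (C : numClosedFieldType) (P : planarData C).
Hypothesis HP : is_subfactor_planar_algebra P.
Notation inp := (inputs (fun c => P c)).
Implicit Types (F G W : forall c, {vspace P c}).

Definition iall_mem F cs : inp cs -> Prop :=
  iall (fun c (x : P c) => x \in F c) (cs := cs).

(** Planar subalgebras that contain all the 2-boxes, without regard to the
   involution; the smallest one turns out to be closed under it. *)
Definition subalgebra F : Prop :=
  (forall e, F (2%N, e) = fullv) /\
  (forall ins out (T : tangle ins out) (xs : inp ins), is_planar T ->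
     iall_mem F xs -> act P T xs \in F out).

Lemma iall_mono F G cs (xs : inp cs) :
  (forall c, F c <= G c)%VS -> iall_mem F xs -> iall_mem G xs.
Proof.
move=> FG; elim: cs xs => //= c cs IHcs [x xs] [/= x_F xs_F].
by split; [apply: subvP x_F | apply: IHcs].
Qed.

Lemma subalgebra_cap F G :
  subalgebra F -> subalgebra G -> subalgebra (fun c => F c :&: G c)%VS.
Proof.
move=> [F2 F_act] [G2 G_act]; split=> [e | ins out T xs pT xs_FG].
  by rewrite F2 G2 capvv.
rewrite memv_cap F_act ?G_act //; apply: iall_mono xs_FG => c;
  [exact: capvSr|exact: capvSl].
Qed.

(** Each box space is finite-dimensional, so for each color [c] some subalgebra
   [M c] is smallest at [c]; the diagonal [c |-> M c c] is the intersection of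
   all subalgebras. *)
Lemma smallest_subalgebra : exists2 W, subalgebra W &
  forall F, subalgebra F -> forall c, (W c <= F c)%VS.
Proof.
have min_at c : exists2 F, subalgebra F & forall G, subalgebra G ->
  (F c <= G c)%VS.
  have ex_d : exists d, boolp.asbool (exists2 F, subalgebra F & \dim (F c) = d).
    exists (\dim {:P c}); apply/boolp.asboolP.
    exists (fun c => fullv) => //; split=> // *; exact: memvf.
  case: (ex_minnP ex_d) => _ /boolp.asboolP[F F_sub <-] d_min.
  exists F => // G G_sub; apply/capv_idPl/eqP; rewrite eqEdim capvSl d_min //.
  by apply/boolp.asboolP; exists (fun c => F c :&: G c)%VS => //;
    apply: subalgebra_cap.
have {}min_at c : exists F, subalgebra F /\ forall G, subalgebra G ->
  (F c <= G c)%VS.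
  by have [F] := min_at c; exists F.
have [M M_min] := boolp.choice min_at.
exists (fun c => M c c); last by move=> F F_sub c; apply: (M_min c).2.
split=> [e | ins out T xs pT xs_M]; first exact: (M_min _).1.1.
apply: (M_min out).1.2 => //; apply: iall_mono xs_M => c.
exact: (M_min c).2 (M_min out).1.
Qed.

Lemma starD c (x y : P c) : star P (x + y) = star P x + star P y.
Proof. by have := star_antilinear HP 1 x y; rewrite rmorph1 !scale1r. Qed.
Lemma star0 c : star P (0 : P c) = 0.
Proof.
by have := starD (0 : P c) 0; rewrite addr0 => /eqP;
  rewrite -subr_eq0 opprD addrA subrr sub0r oppr_eq0 => /eqP.
Qed.
Lemma starZ c a (x : P c) : star P (a *: x) = a^* *: star P x.
Proof. by have := star_antilinear HP a x 0; rewrite star0 !addr0. Qed.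
Lemma star_sum c (I : finType) (f : I -> P c) :
  star P (\sum_i f i) = \sum_i star P (f i).
Proof. by apply: (big_morph _ (@starD c) (star0 c)). Qed.

(** The preimage of [W c] under the involution; as the latter is antilinear,
   this is written as the span of an image. *)
Definition star_family W c := <<[seq star P x | x <- vbasis (W c)]>>%VS.

Lemma mem_star_family W c (x : P c) : (x \in star_family W c) =
  (star P x \in W c).
Proof.
apply/idP/idP => [/(@coord_span _ _ _ (in_tuple _))-> | x_W].
  rewrite star_sum; apply: memv_suml => i _; rewrite starZ; apply: memvZ.
  have : (in_tuple [seq star P x | x <- vbasis (W c)])`_i \in
    [seq star P x | x <- vbasis (W c)].
    exact: mem_nth.
  by case/mapP=> y y_W ->; rewrite (starK HP); apply: vbasis_mem.
rewrite -(starK HP x) (coord_vbasis x_W) star_sum; apply: memv_suml => i _.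
rewrite starZ; apply/memvZ/memv_span/map_f; apply: mem_nth.
by rewrite size_tuple.
Qed.

Lemma subalgebra_star W : subalgebra W -> subalgebra (star_family W).
Proof.
move=> [W2 W_act]; split=> [e | ins out T xs pT xs_W].
  by apply/vspaceP=> x; rewrite mem_star_family W2 !memvf.
rewrite mem_star_family (act_star HP) //; apply: W_act;
  first exact: planar_reflect.
elim: ins xs {T pT} xs_W => //= c cs IHcs [x xs] [/= x_W xs_W].
by split; [rewrite -mem_star_family | apply: IHcs].
Qed.
End Families.

Section Sub.
Variables (C : numClosedFieldType) (P : planarData C).
Variable W : forall c, {vspace P c}.
Notation V := (fun c => subvs_of (W c)).

Fixpoint ival (cs : seq color) : inputs V cs -> inputs (fun c => P c) cs :=
  match cs with
  | [::] => id
  | c :: cs' => fun xs => (vsval xs.1, ival xs.2)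
  end.

(** Projecting onto [W out] makes the action total; on planar tangles the result
   already lies in [W out]. *)
Definition sub_data : planarData C :=
  @PlanarData C (fun c => subvs_of (W c) : vectType C)
    (fun ins out T xs => vsproj (W out) (act P T (ival xs)))
    (fun c x => vsproj (W c) (star P (vsval x))) (delta P).
Local Notation Q := sub_data.
Notation inq := (inputs (fun c => Q c)).

Hypothesis HP : is_subfactor_planar_algebra P.
Hypothesis W_sub : subalgebra W.
Hypothesis W_star : forall c (x : P c), x \in W c -> star P x \in W c.

Lemma ival_mem cs (xs : inq cs) : iall_mem W (ival xs).
Proof.
by elim: cs xs => [|c cs IHcs] // [x xs]; split; [apply: subvsP | apply: IHcs].
Qed.

Lemma ival_cat cs ds (xs : inq cs) (ys : inq ds) :
  ival (icat xs ys) = icat (ival xs) (ival ys).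
Proof. by elim: cs xs => //= c cs IHcs [x xs]; rewrite IHcs. Qed.

Lemma ival_ins_at cs ds c (xs : inq cs) (x : Q c) (ys : inq ds) :
  ival (ins_at xs x ys) = ins_at (ival xs) (vsval x) (ival ys).
Proof. by rewrite /ins_at ival_cat. Qed.

Lemma val_act ins out (T : tangle ins out) (xs : inq ins) :
  is_planar T -> vsval (act Q T xs) = act P T (ival xs).
Proof.
by move=> pT; rewrite vsprojK //; apply: W_sub.2 => //; apply: ival_mem.
Qed.

Lemma val_star c (x : Q c) : vsval (star Q x) = star P (vsval x).
Proof. by rewrite vsprojK //; apply/W_star/subvsP. Qed.

Lemma ival_star cs (xs : inq cs) :
  ival (imap (fun c => @star C Q c) xs) = imap (fun c => @star C P c) (ival xs).
Proof. by elim: cs xs => //= c cs IHcs [x xs]; rewrite IHcs val_star. Qed.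

Lemma valQ_inj c (x y : Q c) : vsval x = vsval y -> x = y.
Proof. exact: val_inj. Qed.

Lemma val_lin c a (x y : Q c) : vsval (a *: x + y) = a *: vsval x + vsval y.
Proof. exact: linearP. Qed.

Lemma valZ c a (x : Q c) : vsval (a *: x) = a *: vsval x.
Proof. exact: linearZ. Qed.

Lemma dim_sub c : \dim {:P c} = 1%N -> (exists2 x, x \in W c & x != 0) ->
  \dim {:Q c} = 1%N.
Proof.
move=> dimP [x x_W x_neq0]; rewrite dimvf.
change (\dim (W c) = 1%N); apply/eqP; rewrite eqn_leq -{1}dimP dimvS ?subvf //=.
by rewrite lt0n dimv_eq0; apply: contraNneq x_neq0 => W0; rewrite -memv0 -W0.
Qed.

Lemma sub_planar : is_subfactor_planar_algebra Q.
Proof.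
split.
- move=> ins out T T' xs pT pT' iso; apply: valQ_inj.
  by rewrite /= !val_act // (act_isotopic HP _ pT pT' iso).
- move=> cs ds c out T xs ys a x y pT; apply: valQ_inj.
  by rewrite [RHS]val_lin !val_act // !ival_ins_at val_lin (act_linear HP).
- move=> c x; apply: valQ_inj; rewrite /= vsprojK (act_id HP) //; exact: subvsP.
- move=> cs ds c d out T xs ys x y pT; apply: (congr1 (vsproj (W out))).
  by rewrite !ival_ins_at /= (act_swap HP).
- move=> cs ds es c out T S xs ys zs pT pS; apply: (congr1 (vsproj (W out))).
  by rewrite ival_ins_at val_act // !ival_cat (act_glue HP).
- move=> c a x y; apply: valQ_inj.
  by rewrite [RHS]val_lin !val_star val_lin (star_antilinear HP).
- by move=> c x; apply: valQ_inj; rewrite !val_star (starK HP).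
- move=> ins out T xs pT; apply: valQ_inj.
  by rewrite val_star val_act ?val_act ?planar_reflect // (act_star HP) //
    ival_star.
- exact: (delta_gt0 HP).
- move=> ins out m l xs pT; apply: valQ_inj.
  by rewrite valZ !val_act // (act_loops HP).
- move=> e; apply: dim_sub (space0 HP e) _.
  exists (act P (empty_tangle e) tt); last exact: (empty_neq0 HP).
  by apply: (W_sub.2 [::]); case: (e); vm_compute.
(* Only the result of the pairing has to lie in the subalgebra, and it is a
   multiple of the empty diagram. *)
- move=> c x x_neq0; have [|s s_gt0 xs] := inner_prod_gt0 HP (x := vsval x).
    by apply: contraNneq x_neq0 => x0; apply/eqP/valQ_inj; rewrite x0 linear0.
  exists s => //; rewrite -[RHS]linearZ -xs -val_star.
  by [].
Qed.

Definition strand_tangle e : tangle [::] (1%N, e) :=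
  of_strings [::] (1%N, e) [:: ((0, 0), (0, 1))]%N.

(** Closing the strand gives a loop, that is [delta] times the empty diagram. *)
Lemma strand_neq0 e : act P (strand_tangle e) tt != 0.
Proof.
pose cap : tangle [:: (1%N, e)] (0%N, e) := of_strings [:: (1%N, e)] (0%N, e)
  [:: ((1, 0), (1, 1))]%N.
have cap_strand : act P cap (act P (strand_tangle e) tt, tt) =
    delta P *: act P (empty_tangle e) tt.
  rewrite -[delta P]expr1 -(act_loops HP); last by case: (e); vm_compute.
  apply: (act_subst HP (cs := [::]) (ds := [::]) tt tt
    (tt : inputs (fun c => P c) [::])).
  by rewrite /cap; case: (e); vm_compute.
have : act P cap (act P (strand_tangle e) tt, tt) != 0.
  by rewrite cap_strand scaler_eq0 (gt_eqF (delta_gt0 HP))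
    (negPf (empty_neq0 HP e)).
apply: contraNneq => ->.
have := @act_linear _ _ HP [::] [::] (1%N, e) _ cap tt tt (-1) 0 0.
rewrite scaler0 addr0 scaleN1r addNr => -> //.
by rewrite /cap; case: (e); vm_compute.
Qed.

Lemma sub_irreducible : is_irreducible P -> is_irreducible Q.
Proof.
move=> irrP e; apply: dim_sub (irrP e) _.
exists (act P (strand_tangle e) tt); last exact: strand_neq0.
by apply: (W_sub.2 [::]); case: (e); vm_compute.
Qed.

Definition into_sub2 (x : P c2) : Q c2 := vsproj (W c2) x.

Lemma into_sub2K x : vsval (into_sub2 x) = x.
Proof. by rewrite vsprojK // W_sub.1 memvf. Qed.

Lemma val_sub2K (x : Q c2) : into_sub2 (vsval x) = x.
Proof. exact: vsvalK. Qed.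

Lemma val_mul (x y : Q c2) : vsval (mul x y) = mul (vsval x) (vsval y).
Proof. by rewrite /mul val_act; last by vm_compute. Qed.

Lemma val_conv (x y : Q c2) : vsval (conv x y) = conv (vsval x) (vsval y).
Proof. by rewrite /conv val_act; last by vm_compute. Qed.

Lemma val_jones : vsval (jones_proj Q) = jones_proj P.
Proof. by rewrite /jones_proj valZ val_act; last by vm_compute. Qed.

Lemma val_projection (q : Q c2) : is_projection q <-> is_projection (vsval q).
Proof.
rewrite /is_projection -val_mul -val_star.
by split=> -[q1 q2]; split; rewrite ?q1 ?q2 //; apply: valQ_inj.
Qed.

Lemma val_minimal (q : Q c2) : is_minimal_projection q <->
  is_minimal_projection (vsval q).
Proof.
split=> [[q_proj q_neq0 q_min] | [q_proj q_neq0 q_min]]; split.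
- exact/val_projection.
- by apply: contraNneq q_neq0 => q0; apply/eqP/valQ_inj; rewrite q0 linear0.
- move=> r r_proj qr rq.
  case: (q_min (into_sub2 r)).
  + by apply/val_projection; rewrite into_sub2K.
  + by apply: valQ_inj; rewrite val_mul into_sub2K.
  + by apply: valQ_inj; rewrite val_mul into_sub2K.
  + by move=> r0; left; rewrite -[r]into_sub2K r0 linear0.
  + by move=> <-; right; rewrite into_sub2K.
- exact/val_projection.
- by apply: contraNneq q_neq0 => ->; rewrite linear0.
- move=> r r_proj qr rq.
  case: (q_min (vsval r)).
  + exact/val_projection.
  + by rewrite -val_mul qr.
  + by rewrite -val_mul rq.
  + by move=> r0; left; apply: valQ_inj; rewrite r0 linear0.
  + by move=> rE; right; apply: valQ_inj.
Qed.

Lemma sub_abelian n (p : 'I_n.+1 -> P c2) :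
  is_abelian_with p -> is_abelian_with (P := Q) (into_sub2 \o p).
Proof.
case=> _ irrP mulC p_inj p_min p0; split.
- exact: sub_planar.
- exact: sub_irreducible.
- by move=> x y; apply: valQ_inj; rewrite !val_mul mulC.
- by move=> i j /= /(congr1 vsval); rewrite !into_sub2K => /p_inj.
- move=> q; rewrite val_minimal p_min; split=> -[i qi]; exists i.
    by rewrite /= -qi val_sub2K.
  by rewrite qi into_sub2K.
- by apply: valQ_inj; rewrite val_jones -p0; apply: into_sub2K.
Qed.

(** The inclusion is the identity on 2-boxes and commutes with all planar
   operations. *)
Lemma sub_realizes n (p : 'I_n.+1 -> P c2) (B : fusionBialgebra C n) :
  realizes p B -> realizes (P := Q) (into_sub2 \o p) B.
Proof.
case=> pP [d [phi [d_p [g phiK gK] phiM phi_x phi_star]]].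
split; first exact: sub_abelian.
exists d, (vsproj (W c2) \o phi : {linear B -> Q c2}).
have val_phi x : vsval (into_sub2 (phi x)) = phi x by rewrite into_sub2K.
split.
- move=> j; apply: valQ_inj; rewrite valZ /close_right /strand.
  rewrite [LHS]val_act; last by vm_compute.
  rewrite [in RHS]val_act; last by vm_compute.
  by rewrite /= into_sub2K; apply: d_p.
- exists (g \o vsval) => x /=; first by rewrite val_phi phiK.
  by rewrite gK; apply: val_sub2K.
- by move=> x y; apply: valQ_inj; rewrite val_conv /= !val_phi phiM.
- by move=> j; apply: valQ_inj; rewrite valZ /= val_phi into_sub2K phi_x.
- move=> j; apply: valQ_inj; rewrite /rot180 val_act; last by vm_compute.
  by rewrite /= !val_phi phi_star.
Qed.

Hypothesis W_min : forall F, subalgebra F -> forall c, (W c <= F c)%VS.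

(** A planar subalgebra of the subalgebra is also one of [P], and [W] is the
   smallest. *)
Lemma sub_generated : generated_by_2boxes Q.
Proof.
move=> F F2 F_act c.
pose G c : {vspace P c} := (linfun (vsval : Q c -> P c) @: F c)%VS.
have mem_G c' (x : P c') : x \in G c' -> exists2 y : Q c', y \in F c' &
  vsval y = x.
  by case/memv_imgP=> y y_F ->; exists y; rewrite // lfunE.
have G_val c' (y : Q c') : y \in F c' -> vsval y \in G c'.
  by move=> y_F; rewrite -[vsval y](lfunE (vsval : {linear Q c' -> P c'}))
    memv_img.
have G_sub : subalgebra G.
  split=> [e | ins out T xs pT xs_G].
    apply/vspaceP=> x; rewrite memvf; rewrite -(@vsprojK _ _ (W (2%N, e)) x).
      by apply: G_val; rewrite F2 memvf.
    by rewrite W_sub.1 memvf.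
  have [ys ys_F <-] : exists2 ys : inputs (fun c => Q c) ins,
      iall (fun c (y : Q c) => y \in F c) ys & ival ys = xs.
    elim: ins xs xs_G {T pT} => [|c' cs IHcs] /=; first by move=> [] _;
      exists tt.
    case=> x xs [/= x_G xs_G]; have [y y_F yx] := mem_G _ _ x_G.
    by have [ys ys_F ysx] := IHcs xs xs_G; exists (y, ys) => //=;
      rewrite yx ysx.
  by rewrite -val_act //; apply: G_val; apply: F_act.
apply/vspaceP=> y; rewrite memvf.
have /mem_G[z z_F zy] : vsval y \in G c by apply: subvP (W_min G_sub c) _
  (subvsP y).
by rewrite -(valQ_inj zy).
Qed.
End Sub.

Lemma exists_generated (C : numClosedFieldType) n (B : fusionBialgebra C n)
    (P : planarData C) (p : 'I_n.+1 -> P c2) :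
  realizes p B ->
  exists (Q : planarData C) (q : 'I_n.+1 -> Q c2), realizes q B /\
    generated_by_2boxes Q.
Proof.
move=> pB; have HP := aw_subfactor pB.1.
have [W W_sub W_min] := smallest_subalgebra P.
have W_star c (x : P c) : x \in W c -> star P x \in W c.
  move=> x_W; rewrite -(mem_star_family HP).
  by apply: subvP (W_min _ (subalgebra_star HP W_sub) c) _ x_W.
exists (sub_data W), (into_sub2 W \o p); split; first exact: sub_realizes.
exact: sub_generated.
Qed.

(** * The theorem *)

Theorem theorem1p2 (R : realType) (n : nat) (B : fusionBialgebra R[i]%C n) :
  subfactorizable B ->
  (has_exchange_relation B <->
   forall k : 'I_n.+1, is_forest (fusion_graph B k)).
Proof.
case=> P [p pB]; split=> [[P' [p' [p'B [_ rel]]]] | forests].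
  exact/(exchange_forest p'B).
have [Q [q [qB Q_gen]]] := exists_generated pB.
by exists Q, q; split=> //; split=> //; apply/(exchange_forest qB).
Qed.
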